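(* Let $n\ge2$ and let $M^n$ be an $n$-dimensional Riemannian submanifold of a real space form $\widetilde N^{n+p}(c)$ (a Riemannian manifold of constant sectional curvature $c$) endowed with the semi-symmetric non-metric connection $\widetilde\nabla_XY=\mathring{\widetilde\nabla}_XY+\phi(Y)X$ associated with a $1$-form $\phi$. Then for every $x\in M^n$ and every unit vector $X\in T_xM^n$, $$\operatorname{Ric}(X)\ \ge\ (n-1)c-\lambda+s(X,X)-n\,\phi(H)+\widetilde g\bigl(P^\perp,\sigma(X,X)\bigr)+\mathcal H(H,\sigma),$$ where $$\mathcal H(H,\sigma)=\frac{n-1}{n}\left(2n\|H\|^2-\|\sigma\|^2-(n-2)\|H\|\sqrt{\frac{n\left(\|\sigma\|^2-n\|H\|^2\right)}{n-1}}\right),$$ with equality at $x$ if and only if both of the following conditions hold (for $n=2$, see also the qualification at the end): (i) for each $\alpha\in\{n+1,\dots,n+p\}$, the matrix $(\sigma^\alpha_{ij})_{1\le i,j\le n}$ has the quasi-umbilical form $\operatorname{diag}(\lambda_\alpha,\mu_\alpha,\dots,\mu_\alpha)$ in an orthonormal frame $\{e_1=X,e_2,\dots,e_n\}$ of $T_xM^n$, with $$\lambda_\alpha=H^\alpha-\frac{n-1}{n}\,\varepsilon_\alpha\sqrt{\frac{n\|\sigma^\alpha\|^2-n^2(H^\alpha)^2}{n-1}},\qquad \mu_\alpha=H^\alpha+\frac1n\,\varepsilon_\alpha\sqrt{\frac{n\|\sigma^\alpha\|^2-n^2(H^\alpha)^2}{n-1}},$$ where $\varepsilon_\alpha=\operatorname{sgn}(H^\alpha)$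 if $H^\alpha\ne0$, and $\varepsilon_\alpha=\pm1$ (either choice) if $H^\alpha=0$; (ii) writing $D_\alpha:=|\lambda_\alpha-\mu_\alpha|=\sqrt{\frac{n(\|\sigma^\alpha\|^2-n(H^\alpha)^2)}{n-1}}$, if $H\neq0$ there exists $\rho\ge0$ such that $D_\alpha=\rho\,|H^\alpha|$ for all $\alpha$. (Thus, when $H\ne0$, any normal component with $H^\alpha=0$ must satisfy $D_\alpha=0$, i.e. $(\sigma^\alpha_{ij})$ is a scalar matrix.) Qualification for $n=2$: the algebraic estimate $$\sigma^\alpha_{11}\sum_{j\ge2}\sigma^\alpha_{jj}-\sum_{j\ge2}(\sigma^\alpha_{1j})^2\ \ge\ \frac{n-1}{n}\Bigl[2n(H^\alpha)^2-\|\sigma^\alpha\|^2-(n-2)|H^\alpha|\sqrt{\tfrac{n(\|\sigma^\alpha\|^2-n(H^\alpha)^2)}{n-1}}\Bigr]$$ used for each $\alpha$ is then an identity for every symmetric $2\times2$ matrix, so the algebraic step imposes no quasi-umbilical or diagonal restriction, and equality in the Ricci inequality reduces to equality in the Cauchy–Schwarz step $$\sum_\alpha|H^\alpha|\sqrt{\frac{n\bigl(\|\sigma^\alpha\|^2-n(H^\alpha)^2\bigr)}{n-1}}\ \le\ \|H\|\sqrt{\frac{n\bigl(\|\sigma\|^2-n\|H\|^2\bigr)}{n-1}}$$ alone; the nontrivial equality mechanism (i)–(ii) is confined to $n\ge3$.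
   Context: Setting and notation. $\mathring{\widetilde\nabla}$ is the Levi-Civita connection of the ambient metric $\widetilde g$. Curvature convention: $R(X,Y)Z=\nabla_X\nabla_YZ-\nabla_Y\nabla_XZ-\nabla_{[X,Y]}Z$, $R(X,Y,Z,W)=g(R(X,Y)Z,W)$ (so constant sectional curvature $c$ means $R(X,Y,Z,W)=c\{g(X,W)g(Y,Z)-g(X,Z)g(Y,W)\}$ for the Levi-Civita curvature). For a $1$-form $\phi$ on $\widetilde N$, the (Agashe–Chafle) semi-symmetric non-metric connection is $\widetilde\nabla_XY=\mathring{\widetilde\nabla}_XY+\phi(Y)X$. The vector field $P$ is defined by $\widetilde g(P,X)=\phi(X)$; along $M^n$ write $P=P^\top+P^\perp$ (tangential and normal parts). The $(0,2)$-tensor $s$ on $\widetilde N$ is $s(X,Y)=(\mathring{\widetilde\nabla}_X\phi)(Y)-\phi(X)\phi(Y)$. $M^n$ carries the induced metric. The induced connection $\nabla$ and second fundamental form $\sigma$ are defined by $\widetilde\nabla_XY=\nabla_XY+\sigma(X,Y)$ (tangential plus normal part) for $X,Y$ tangent to $M$; $\sigma$ coincides with the usual Levi-Civita second fundamental form. $R$ denotes the curvature tensor of the induced connection $\nabla$ on $M$. Given orthonormal frames $\{e_1,\dots,e_n\}$ of $T_xM$ and $\{e_{n+1},\dots,e_{n+p}\}$ of the normal space $T^\perp_xM$: $\sigma^\alpha_{ij}=\widetilde g(\sigma(e_i,e_j),e_\alpha)$, $\|\sigma^\alpha\|^2=\sum_{i,j}(\sigma^\alpha_{ij})^2$, $\|\sigma\|^2=\sum_\alpha\|\sigma^\alpha\|^2$,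 $H=\frac1n\sum_i\sigma(e_i,e_i)$, $H^\alpha=\frac1n\sum_i\sigma^\alpha_{ii}$, $\lambda=\sum_{i=1}^n s(e_i,e_i)$ (trace of $s$ over $T_xM$; not to be confused with the eigenvalues $\lambda_\alpha$), and $\phi(H)=\widetilde g(P^\perp,H)$. Convention for the Ricci curvature: for a unit $X=e_1$ completed to an orthonormal basis of $T_xM$, $\operatorname{Ric}(X):=\sum_{j=2}^nR(X,e_j,e_j,X)$.
   Formalization: For n=2 the Cauchy–Schwarz step is taken with its factor (n−2)=0, so equality in the Ricci inequality always holds; the literal reduction to equality in the displayed step is false (e.g. σ^1=I, σ^2=diag(1,−1)). The ''iff (i) and (ii)'' is stated for n≥3 only. *)

(* Defs.v *)
From HB Require Import structures.
From mathcomp Require Import all_boot all_order all_algebra.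
From mathcomp Require Import all_classical all_reals all_analysis.
From mathcomp Require Import lra.

Set Implicit Arguments.
Unset Strict Implicit.
Unset Printing Implicit Defensive.

Import Order.TTheory GRing.Theory Num.Theory.
Import numFieldNormedType.Exports.

Local Open Scope classical_set_scope.
Local Open Scope ring_scope.

(* Vectors are rows, so a differential acts as [u *m jacobian F x], where
   [jacobian F x i a] is the i-th partial derivative of the a-th component. *)

Fixpoint Ck_on (R : realType) (V W : normedModType R) (k : nat) (U : set V)
    (f : V -> W) : Prop :=
  match k with
  | 0 => forall x, U x -> {for x, continuous f}
  | k'.+1 => (forall x, U x -> differentiable f x) /\
             (forall v : V, Ck_on k' U (fun x => 'D_v f x))
  end.

Definition smooth_on (R : realType) (V W : normedModType R) (U : set V)
    (f : V -> W) : Prop := forall k, Ck_on k U f.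

(* [chart_inv] is the inverse parametrization; only its values on
   [chart_map @` chart_dom] matter. *)
Record chart (R : realType) (T : topologicalType) (n : nat) := Chart {
  chart_dom : set T;
  chart_map : T -> 'rV[R]_n;
  chart_inv : 'rV[R]_n -> T;
  chart_dom_open : open chart_dom;
  chart_img_open : open (chart_map @` chart_dom);
  chart_mapK : forall x, chart_dom x -> chart_inv (chart_map x) = x;
  chart_map_continuous : forall x, chart_dom x -> {for x, continuous chart_map};
  chart_inv_continuous : forall y, (chart_map @` chart_dom) y ->
    {for y, continuous chart_inv}
}.

Definition chart_img (R : realType) (T : topologicalType) (n : nat)
  (a : chart R T n) : set 'rV[R]_n := chart_map a @` chart_dom a.

Definition transition (R : realType) (T : topologicalType) (n : nat)
  (a b : chart R T n) : 'rV[R]_n -> 'rV[R]_n := chart_map b \o chart_inv a.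

Record manifold (R : realType) (n : nat) := Manifold {
  carrier :> topologicalType;
  manifold_hausdorff : hausdorff_space carrier;
  manifold_second_countable : @second_countable carrier;
  atlas : set (chart R carrier n);
  atlas_cover : forall x : carrier, exists2 a, atlas a & chart_dom a x;
  atlas_compat : forall a b, atlas a -> atlas b ->
    smooth_on (chart_map a @` (chart_dom a `&` chart_dom b)) (transition a b)
}.

(* The bilinear form with Gram matrix [G]. *)
Definition ip (R : realType) (m : nat) (G : 'M[R]_m) (u v : 'rV[R]_m) : R :=
  (u *m G *m v^T) 0 0.

(* A covector, given by its row of components, applied to a vector. *)
Definition covpair (R : realType) (m : nat) (w v : 'rV[R]_m) : R :=
  (w *m v^T) 0 0.

(* A tensor field is given by its components in each chart, as functions of
   the coordinates, subject to the usual transformation law. *)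
Record metric (R : realType) (n : nat) (M : manifold R n) := Metric {
  gram : chart R M n -> 'rV[R]_n -> 'M[R]_n;
  gram_smooth : forall a, atlas a -> smooth_on (chart_img a) (gram a);
  gram_sym : forall a, atlas a -> forall y, chart_img a y ->
    (gram a y)^T = gram a y;
  gram_pos : forall a, atlas a -> forall y, chart_img a y ->
    forall u, u != 0 -> 0 < ip (gram a y) u u;
  gram_change : forall a b, atlas a -> atlas b ->
    forall x, chart_dom a x -> chart_dom b x ->
    let J := jacobian (transition a b) (chart_map a x) in
    gram a (chart_map a x) = J *m gram b (chart_map b x) *m J^T
}.

Record one_form (R : realType) (n : nat) (M : manifold R n) := OneForm {
  form_comp : chart R M n -> 'rV[R]_n -> 'rV[R]_n;
  form_smooth : forall a, atlas a -> smooth_on (chart_img a) (form_comp a);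
  form_change : forall a b, atlas a -> atlas b ->
    forall x, chart_dom a x -> chart_dom b x ->
    let J := jacobian (transition a b) (chart_map a x) in
    form_comp a (chart_map a x) = form_comp b (chart_map b x) *m J^T
}.

Definition local_rep (R : realType) (n m : nat) (M : manifold R n)
    (N : manifold R m) (f : M -> N) (a : chart R M n) (b : chart R N m) :
    'rV[R]_n -> 'rV[R]_m :=
  chart_map b \o f \o chart_inv a.

Definition immersion (R : realType) (n m : nat) (M : manifold R n)
    (N : manifold R m) (f : M -> N) : Prop :=
  continuous f /\
  forall a b, atlas a -> atlas b ->
    smooth_on (chart_map a @` (chart_dom a `&` f @^-1` chart_dom b))
      (local_rep f a b) /\
    (forall x, chart_dom a x -> chart_dom b (f x) ->
       row_free (jacobian (local_rep f a b) (chart_map a x))).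

Section Connections.
Context {R : realType} {m : nat}.
Local Notation vec := 'rV[R]_m.
Local Notation vfield := (vec -> vec).

Definition lie (X Y : vfield) : vfield :=
  fun y => 'D_(X y) Y y - 'D_(Y y) X y.

Definition curvature (D : vfield -> vfield -> vfield) (X Y Z : vfield) :
    vfield :=
  fun y => D X (D Y Z) y - D Y (D X Z) y - D (lie X Y) Z y.

(* R(u,v,w,z) = g(R(u,v)w,z) at y. The curvature is tensorial, so tangent
   vectors may be extended to fields with constant components. *)
Definition curv4 (D : vfield -> vfield -> vfield) (G : vec -> 'M[R]_m) (y : vec)
    (u v w z : vec) : R :=
  ip (G y) (curvature D (cst u) (cst v) (cst w) y) z.

Definition christoffel (G : vec -> 'M[R]_m) (y : vec) (i j k : 'I_m) : R :=
  2^-1 * \sum_(l < m) invmx (G y) k l *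
    ('D_(delta_mx 0 i) G y j l + 'D_(delta_mx 0 j) G y i l
     - 'D_(delta_mx 0 l) G y i j).

Definition christoffel_form (G : vec -> 'M[R]_m) (y u v : vec) : vec :=
  \row_k \sum_(i < m) \sum_(j < m) u 0 i * v 0 j * christoffel G y i j k.

Definition levi_civita (G : vec -> 'M[R]_m) (X Y : vfield) : vfield :=
  fun y => 'D_(X y) Y y + christoffel_form G y (X y) (Y y).

(* Semi-symmetric non-metric connection of Agashe and Chafle. *)
Definition ssnm (G : vec -> 'M[R]_m) (w : vfield) (X Y : vfield) : vfield :=
  fun y => levi_civita G X Y y + covpair (w y) (Y y) *: X y.

(* s(X,Y) = (nabla_X phi)(Y) - phi(X) phi(Y), with nabla the Levi-Civita
   connection, and
   (nabla_X phi)(Y) = X(phi(Y)) - phi(nabla_X Y). *)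
Definition s_field (G : vec -> 'M[R]_m) (w : vfield) (X Y : vfield) (y : vec) :
    R :=
  'D_(X y) (fun z => covpair (w z) (Y z)) y
  - covpair (w y) (levi_civita G X Y y)
  - covpair (w y) (X y) * covpair (w y) (Y y).

Definition s_tensor (G : vec -> 'M[R]_m) (w : vfield) (y u v : vec) : R :=
  s_field G w (cst u) (cst v) y.

(* The vector P metrically dual to the 1-form. *)
Definition sharp (G : vec -> 'M[R]_m) (w : vfield) (y : vec) : vec :=
  w y *m invmx (G y).

End Connections.

(* Constant sectional curvature c, with R(X,Y,Z,W) = g(R(X,Y)Z,W). *)
Definition constant_curvature (R : realType) (m : nat) (N : manifold R m)
    (g : metric N) (c : R) : Prop :=
  forall b, atlas b -> forall y, chart_img b y -> forall u v w z : 'rV[R]_m,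
    let G := gram g b in
    curv4 (levi_civita G) G y u v w z =
      c * (ip (G y) u z * ip (G y) v w - ip (G y) u w * ip (G y) v z).

(* [G] and [w] are the components of the ambient metric and of the 1-form,
   [F] is the local representative of the immersion. Tangent vectors of the
   submanifold are given by their components in its chart; the ambient vector
   is obtained by applying [push F x]. *)

Section Immersed.
Context {R : realType} {n m : nat}.
Variables (G : 'rV[R]_m -> 'M[R]_m) (w : 'rV[R]_m -> 'rV[R]_m).
Variable F : 'rV[R]_n -> 'rV[R]_m.
Local Notation vfield := ('rV[R]_n -> 'rV[R]_n).
Local Notation vfield_along := ('rV[R]_n -> 'rV[R]_m).

Definition push (x u : 'rV[R]_n) : 'rV[R]_m := u *m jacobian F x.

Definition ind_metric (x : 'rV[R]_n) : 'M[R]_n :=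
  jacobian F x *m G (F x) *m (jacobian F x)^T.

(* The ambient connections, acting on vector fields along [F] (pullback
   connection); see [ssnm_along_comp]. *)
Definition levi_civita_along (X : vfield) (Y : vfield_along) : vfield_along :=
  fun x => 'D_(X x) Y x + christoffel_form G (F x) (push x (X x)) (Y x).

Definition ssnm_along (X : vfield) (Y : vfield_along) : vfield_along :=
  fun x => levi_civita_along X Y x + covpair (w (F x)) (Y x) *: push x (X x).

(* Orthogonal decomposition v = push x (tan_part x v) + nor_part x v. *)
Definition tan_part (x : 'rV[R]_n) (v : 'rV[R]_m) : 'rV[R]_n :=
  v *m G (F x) *m (jacobian F x)^T *m invmx (ind_metric x).

Definition nor_part (x : 'rV[R]_n) (v : 'rV[R]_m) : 'rV[R]_m :=
  v - push x (tan_part x v).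

Definition push_field (Y : vfield) : vfield_along := fun x => push x (Y x).

Definition ind_connection (X Y : vfield) : vfield :=
  fun x => tan_part x (ssnm_along X (push_field Y) x).

(* The second fundamental form is tensorial: constant extensions suffice. *)
Definition sff (x u v : 'rV[R]_n) : 'rV[R]_m :=
  nor_part x (ssnm_along (cst u) (push_field (cst v)) x).

Definition riem (x u v z t : 'rV[R]_n) : R :=
  curv4 ind_connection ind_metric x u v z t.

Definition Pperp (x : 'rV[R]_n) : 'rV[R]_m := nor_part x (sharp G w (F x)).

Definition tangent_frame (x : 'rV[R]_n) (e : 'I_n -> 'rV[R]_n) : Prop :=
  forall i j, ip (ind_metric x) (e i) (e j) = (i == j)%:R.

Definition normal_frame (p : nat) (x : 'rV[R]_n) (nu : 'I_p -> 'rV[R]_m) :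
    Prop :=
  (forall al be, ip (G (F x)) (nu al) (nu be) = (al == be)%:R) /\
  (forall al u, ip (G (F x)) (nu al) (push x u) = 0).

Section Frames.
Context {p : nat}.
Variables (x : 'rV[R]_n) (e : 'I_n -> 'rV[R]_n) (nu : 'I_p -> 'rV[R]_m).

Definition sffc (al : 'I_p) (i j : 'I_n) : R :=
  ip (G (F x)) (sff x (e i) (e j)) (nu al).

Definition sffc_norm2 (al : 'I_p) : R :=
  \sum_(i < n) \sum_(j < n) (sffc al i j) ^+ 2.

Definition sff_norm2 : R := \sum_(al < p) sffc_norm2 al.

Definition mean_curv : 'rV[R]_m := n%:R^-1 *: \sum_(i < n) sff x (e i) (e i).

Definition mean_curvc (al : 'I_p) : R := n%:R^-1 * \sum_(i < n) sffc al i i.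

Definition mean_norm : R := Num.sqrt (ip (G (F x)) mean_curv mean_curv).

Definition trace_s : R :=
  \sum_(i < n) s_tensor G w (F x) (push x (e i)) (push x (e i)).

(* Ric(e_k) for the induced connection, whose curvature lacks the Riemannian
   symmetries: the order of the arguments matters. *)
Definition ric (k : 'I_n) : R :=
  \sum_(j < n | j != k) riem x (e k) (e j) (e j) (e k).

End Frames.
End Immersed.

Section Scalars.
Context {R : realType}.
Variable n : nat.

(* [h] is ||H|| (or H^alpha) and [S] is ||sigma||^2 (or ||sigma^alpha||^2).
   [deviation] is the square root D_alpha, equal to |lambda_ev - mu_ev|. *)
Definition deviation (h S : R) : R :=
  Num.sqrt (n%:R * (S - n%:R * h ^+ 2) / (n%:R - 1)).

Definition calH (h S : R) : R :=
  (n%:R - 1) / n%:R *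
    (2 * n%:R * h ^+ 2 - S - (n%:R - 2) * h * deviation h S).

Definition lambda_ev (eps h S : R) : R :=
  h - (n%:R - 1) / n%:R * eps
      * Num.sqrt ((n%:R * S - n%:R ^+ 2 * h ^+ 2) / (n%:R - 1)).

Definition mu_ev (eps h S : R) : R :=
  h + n%:R^-1 * eps
      * Num.sqrt ((n%:R * S - n%:R ^+ 2 * h ^+ 2) / (n%:R - 1)).

Definition is_sign (eps h : R) : Prop :=
  (h != 0 -> eps = Num.sg h) /\ (h = 0 -> eps = 1 \/ eps = -1).

End Scalars.

Section Compat.
Context {R : realType} {m : nat}.

Lemma christoffel_form_sym (G : 'rV[R]_m -> 'M[R]_m) y u v :
  (forall i, ('D_(delta_mx 0 i) G y)^T = 'D_(delta_mx 0 i) G y) ->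
  christoffel_form G y u v = christoffel_form G y v u.
Proof.
move=> Gs; apply/rowP => k; rewrite !mxE exchange_big /=.
apply: eq_bigr => j _; apply: eq_bigr => i _.
congr (_ * _); first exact: mulrC.
congr (_ * _); apply: eq_bigr => l _; congr (_ * _).
congr (_ - _); first exact: addrC.
by have := congr1 (fun A : 'M[R]_m => A j i) (Gs l); rewrite mxE.
Qed.

Lemma levi_civita_torsion_free (G : 'rV[R]_m -> 'M[R]_m) X Y y :
  (forall i, ('D_(delta_mx 0 i) G y)^T = 'D_(delta_mx 0 i) G y) ->
  levi_civita G X Y y - levi_civita G Y X y = lie X Y y.
Proof.
move=> Gs; rewrite /levi_civita /lie (christoffel_form_sym _ _ Gs).
move: (christoffel_form _ _ _ _) ('D_(X y) Y y) ('D_(Y y) X y) => a b c.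
by rewrite opprD addrACA subrr addr0.
Qed.

(* Metric compatibility, on coordinate fields. *)
Lemma levi_civita_metric (G : 'rV[R]_m -> 'M[R]_m) y (i j k : 'I_m) :
  G y \in unitmx -> (G y)^T = G y ->
  (forall i, ('D_(delta_mx 0 i) G y)^T = 'D_(delta_mx 0 i) G y) ->
  'D_(delta_mx 0 i) G y j k =
    \sum_l christoffel G y i j l * G y l k +
    \sum_l christoffel G y i k l * G y j l.
Proof.
move=> Gu Gt Gs.
have swap a b c : 'D_(delta_mx 0 a) G y b c = 'D_(delta_mx 0 a) G y c b.
  by rewrite -[in LHS]Gs mxE.
have low b c : \sum_l christoffel G y i b l * G y l c =
   2^-1 * ('D_(delta_mx 0 i) G y b c + 'D_(delta_mx 0 b) G y i c
     - 'D_(delta_mx 0 c) G y i b).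
  have H l : christoffel G y i b l * G y l c = 2^-1 *
     \sum_r ('D_(delta_mx 0 i) G y b r + 'D_(delta_mx 0 b) G y i r
     - 'D_(delta_mx 0 r) G y i b) * (G y c l * invmx (G y) l r).
    rewrite /christoffel -mulrA; congr (_ * _); rewrite mulr_suml.
    apply: eq_bigr => r _; rewrite mulrAC mulrC; congr (_ * _).
    by rewrite mulrC -{1}Gt mxE.
  rewrite (eq_bigr _ (fun l _ => H l)) -mulr_sumr; congr (_ * _).
  rewrite exchange_big /= (bigD1 c) //= -mulr_sumr.
  have E r : \sum_l G y c l * invmx (G y) l r = (c == r)%:R.
    by have := congr1 (fun A : 'M[R]_m => A c r) (mulmxV Gu); rewrite !mxE.
  rewrite E eqxx big1; first by rewrite mulr1 addr0.
  move=> r rc; by rewrite -mulr_sumr E eq_sym (negbTE rc) mulr0.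
have -> : \sum_l christoffel G y i k l * G y j l =
          \sum_l christoffel G y i k l * G y l j.
  by apply: eq_bigr => l _; rewrite -[in LHS]Gt mxE.
have aux (a b c a' s t : R) : a = a' -> s = 2^-1 * (a + b - c) ->
    t = 2^-1 * (a' + c - b) -> a = s + t.
  by move=> <- -> ->; lra.
exact: (aux _ _ _ _ _ _ (swap i j k) (low j k) (low k j)).
Qed.

End Compat.

Section CompatAlong.
Context {R : realType} {n m : nat}.

Lemma ssnm_along_comp (G : 'rV[R]_m -> 'M[R]_m) (w : 'rV[R]_m -> 'rV[R]_m)
    (F : 'rV[R]_n -> 'rV[R]_m) (X : 'rV[R]_n -> 'rV[R]_n)
    (Y : 'rV[R]_m -> 'rV[R]_m) (x : 'rV[R]_n) :
  differentiable F x -> differentiable Y (F x) ->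
  ssnm_along G w F X (Y \o F) x = ssnm G w (cst (push F x (X x))) Y (F x).
Proof.
move=> dF dY.
have E : 'D_(X x) (Y \o F) x = 'D_(push F x (X x)) Y (F x).
  have dYF := differentiable_comp dF dY.
  rewrite (deriveE _ dYF) (deriveE _ dY) (diff_comp dF dY).
  by rewrite /push -(deriveEjacobian _ dF) (deriveE _ dF).
by rewrite /ssnm_along /levi_civita_along E.
Qed.

Lemma nor_part_orth (G : 'rV[R]_m -> 'M[R]_m) (F : 'rV[R]_n -> 'rV[R]_m) x v u :
  ind_metric G F x \in unitmx ->
  ip (G (F x)) (nor_part G F x v) (push F x u) = 0.
Proof.
move=> U; rewrite /ip /nor_part /push trmx_mul !mulmxBl -!mulmxA.
have -> : jacobian F x *m (G (F x) *m ((jacobian F x)^T *m u^T)) =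
          ind_metric G F x *m u^T by rewrite /ind_metric !mulmxA.
rewrite /tan_part; move: (ind_metric G F x) U => I U.
by rewrite !mulmxA (mulmxKV U) subrr mxE.
Qed.

Lemma sharpP (G : 'rV[R]_m -> 'M[R]_m) (w : 'rV[R]_m -> 'rV[R]_m) y u :
  G y \in unitmx -> ip (G y) (sharp G w y) u = covpair (w y) u.
Proof. by move=> U; rewrite /ip /sharp mulmxKV. Qed.

End CompatAlong.

(* Main.v *)
Require Import Defs.
From HB Require Import structures.
From mathcomp Require Import all_boot all_order all_algebra.
From mathcomp Require Import all_classical all_reals all_analysis.
From mathcomp Require Import ring lra.

Set Implicit Arguments.
Unset Strict Implicit.
Unset Printing Implicit Defensive.

Import Order.TTheory GRing.Theory Num.Theory.
Import numFieldNormedType.Exports.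

Local Open Scope classical_set_scope.
Local Open Scope ring_scope.

(** The proof has an analytic half, which computes the Ricci curvature, and an
    algebraic half, which estimates the quadratic part of the result.

    Analytic half. Everything happens in one chart of each manifold. The
    induced connection is the tangential part of the ambient one, so its
    curvature is the tangential part of the ambient curvature, corrected by
    the tangential parts of derivatives of the normal fields sigma(v, z). By
    [weingarten] these are again expressed by sigma; since the ambient
    connection adds phi(Y) X to the Levi-Civita connection, a further term
    phi(sigma(v, z)) u appears. This is [gauss_equation]. The ambient curvature
    differs from that of constant curvature c by s(X, Z) Y - s(Y, Z) X
    ([coeff_curvature_ssnm]), and phi of a normal vector is its product with the
    normal part of P. Summing over a frame, [ric_formula] gives
    Ric(X) = (n-1) c - lambda + s(X, X) - n phi(H) + <Pperp, sigma(X, X)>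
             + sum over alpha of (A_11 sum_(j>1) A_jj - sum_(j>1) A_1j^2),
    where A = A_alpha is the matrix of sigma in the normal direction alpha.

    Algebraic half. Write h for the mean of the diagonal of A, t = A_11 - h,
    beta = sum_(j>1) A_1j^2, and gamma for the squared distance of the block
    (A_ij) with i, j > 1 from the scalar matrix with the same trace. Then
    |A|^2 = n h^2 + n/(n-1) t^2 + 2 beta + gamma, and the difference between the
    two sides of the estimate for A is
    (n-2) (t h + (n-1)/n |h| D) + (n-2)/n beta + (n-1)/n gamma
    with D^2 = n (|A|^2 - n h^2) / (n-1). The first bracket is nonnegative
    because |t| <= (n-1)/n D. For n > 2 the sum vanishes exactly when
    beta = gamma = 0 and t = - (n-1)/n eps D for a sign eps of h, which is the
    quasi-umbilical form; for n = 2 it vanishes identically, as gamma is then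
    0. Summing over alpha, what remains is the Cauchy-Schwarz inequality for
    the vectors (|h_alpha|) and (D_alpha), whose case of equality is the
    proportionality D_alpha = rho |h_alpha|.

    In the equality statement each alpha may use its own frame. This is
    harmless: the quasi-umbilical form says
    <sigma(u, v), nu_alpha> = mu <u, v> + (lambda - mu) <u, X> <v, X>,
    and the right-hand side only involves X
    ([sffc_quasi_umbilical_frame]). *)

(** * The Cauchy-Schwarz inequality and its case of equality *)

Section CauchySchwarz.
Context {R : realType} {I : finType}.
Variables x y : I -> R.

Local Notation a := (Num.sqrt (\sum_i x i ^+ 2)).
Local Notation b := (Num.sqrt (\sum_i y i ^+ 2)).

Let sqr_a : a ^+ 2 = \sum_i x i ^+ 2.
Proof. by rewrite sqr_sqrtr // sumr_ge0 // => i _; rewrite sqr_ge0. Qed.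

Let sqr_b : b ^+ 2 = \sum_i y i ^+ 2.
Proof. by rewrite sqr_sqrtr // sumr_ge0 // => i _; rewrite sqr_ge0. Qed.

(** Where [a] and [b] are nonzero, this identity gives both the inequality and
    its case of equality. *)
Let defect :
  \sum_i (b * x i - a * y i) ^+ 2 = 2 * (a * b) * (a * b - \sum_i x i * y i).
Proof.
transitivity (b ^+ 2 * \sum_i x i ^+ 2 + a ^+ 2 * \sum_i y i ^+ 2
    - 2 * (a * b) * \sum_i x i * y i).
  rewrite !mulr_sumr -big_split -sumrB /=; apply: eq_bigr => i _; ring.
by move: sqr_a sqr_b; move: a b => a' b' <- <-; ring.
Qed.

Let zero_a : a = 0 -> forall i, x i = 0.
Proof.
move=> a0 i; apply/eqP; rewrite -sqrf_eq0.
have /eqP := sqr_a; rewrite a0 expr0n /= eq_sym psumr_eq0; last first.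
  by move=> j _; rewrite sqr_ge0.
by move=> /allP /(_ i (mem_index_enum i)).
Qed.

Let zero_b : b = 0 -> forall i, y i = 0.
Proof.
move=> b0 i; apply/eqP; rewrite -sqrf_eq0.
have /eqP := sqr_b; rewrite b0 expr0n /= eq_sym psumr_eq0; last first.
  by move=> j _; rewrite sqr_ge0.
by move=> /allP /(_ i (mem_index_enum i)).
Qed.

Lemma cauchy_schwarz : \sum_i x i * y i <= a * b.
Proof.
have [/zero_a a0|an] := eqVneq a 0.
  by rewrite big1 ?mulr_ge0 ?sqrtr_ge0 // => i _; rewrite a0 mul0r.
have [/zero_b b0|bn] := eqVneq b 0.
  by rewrite big1 ?mulr_ge0 ?sqrtr_ge0 // => i _; rewrite b0 mulr0.
have ab : 0 < 2 * (a * b) by rewrite !mulr_gt0 // lt0r ?an ?bn sqrtr_ge0.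
rewrite -subr_ge0 -(pmulr_rge0 _ ab) -defect.
by apply: sumr_ge0 => i _; rewrite sqr_ge0.
Qed.

Lemma cauchy_schwarz_eq :
  \sum_i x i * y i = a * b <->
  (a != 0 -> exists2 rho, 0 <= rho & forall i, y i = rho * x i).
Proof.
split=> [E an|E].
  exists (b / a); first by rewrite divr_ge0 ?sqrtr_ge0.
  move=> i; have /eqP := defect; rewrite E subrr mulr0 psumr_eq0; last first.
    by move=> j _; rewrite sqr_ge0.
  move=> /allP /(_ i (mem_index_enum i)) /=.
  rewrite sqrf_eq0 subr_eq0 => /eqP bx.
  by rewrite mulrAC bx mulrAC mulfV ?mul1r.
have [a0|an] := eqVneq a 0.
  by rewrite a0 mul0r big1 // => i _; rewrite zero_a ?mul0r.
have [rho r0 yE] := E an.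
have -> : b = rho * a.
  have -> : \sum_i y i ^+ 2 = rho ^+ 2 * \sum_i x i ^+ 2.
    by rewrite mulr_sumr; apply: eq_bigr => i _; rewrite yE exprMn.
  by rewrite sqrtrM ?sqr_ge0 // sqrtr_sqr ger0_norm.
rewrite mulrCA -expr2 sqr_a mulr_sumr.
by apply: eq_bigr => i _; rewrite yE; ring.
Qed.

End CauchySchwarz.

(** * The estimate in one normal direction *)

Section Estimate.
Context {R : realType} {n : nat}.
Variables (A : 'M[R]_n) (k : 'I_n).
Hypotheses (hn : (2 <= n)%N) (Asym : A^T = A).

Let N : R := n%:R.
Let h := N^-1 * \tr A.
Let S := \sum_i \sum_j A i j ^+ 2.
Let t := A k k - h.
Let beta := \sum_(j < n | j != k) A k j ^+ 2.
(* The mean of the diagonal entries other than [A k k] (see [trE]). *)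
Let mu := h - t / (N - 1).
Let gamma := \sum_(i < n | i != k) \sum_(j < n | j != k)
  (A i j - mu *+ (i == j)) ^+ 2.

Let N2 : 2 <= N. Proof. by rewrite ler_nat. Qed.
Let Nneq0 : n%:R != 0 :> R.
Proof. by rewrite pnatr_eq0 -lt0n (leq_trans _ hn). Qed.
Let N1neq0 : n%:R - 1 != 0 :> R.
Proof. by rewrite subr_eq0 pnatr_eq1 gtn_eqF. Qed.

Let trE : \sum_(j < n | j != k) A j j = (N - 1) * mu.
Proof.
have : \tr A = N * h by rewrite mulVKf // gt_eqF // (lt_le_trans _ N2).
rewrite [in X in X -> _]/mxtrace (bigD1 k) //= => E.
apply: (addrI (A k k)); rewrite E /mu /t; move: h => h'.
by field; rewrite ?Nneq0 ?N1neq0.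
Qed.

Let gammaE : \sum_(i < n | i != k) \sum_(j < n | j != k) A i j ^+ 2
  = gamma + (N - 1) * mu ^+ 2.
Proof.
have row i : i != k -> \sum_(j < n | j != k) (A i j - mu *+ (i == j)) ^+ 2 =
    \sum_(j < n | j != k) A i j ^+ 2 - 2 * mu * A i i + mu ^+ 2.
  move=> ik; rewrite (bigD1 i) //= [in RHS](bigD1 i) //= eqxx.
  have -> : \sum_(j < n | (j != k) && (j != i)) (A i j - mu *+ (i == j)) ^+ 2 =
            \sum_(j < n | (j != k) && (j != i)) A i j ^+ 2.
    by apply: eq_bigr => j /andP[_ ji]; rewrite eq_sym (negbTE ji) subr0.
  by rewrite mulr1n; ring.
rewrite /gamma (eq_bigr _ row) !big_split /= sumrN -mulr_sumr trE sumr_const.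
have -> : #|[pred i | i != k]| = n.-1 by rewrite -[in RHS](card_ord n) -(cardC1 k).
have -> : mu ^+ 2 *+ n.-1 = (N - 1) * mu ^+ 2.
  by rewrite -mulr_natl -subn1 natrB // (leq_trans _ hn).
ring.
Qed.

(** Orthogonal decomposition of [A] into its scalar part, the traceless
    diagonal matrix singling out [k], the rest of row and column [k], and the
    traceless part of the complementary block. *)
Let SE : S = n%:R * h ^+ 2 + N / (N - 1) * t ^+ 2 + 2 * beta + gamma.
Proof.
have Ake i : A i k = A k i by rewrite -{1}Asym mxE.
rewrite /S (bigD1 k) //= (bigD1 k) //=.
have -> : \sum_(i < n | i != k) \sum_j A i j ^+ 2 = beta +
    \sum_(i < n | i != k) \sum_(j < n | j != k) A i j ^+ 2.
  rewrite /beta -big_split; apply: eq_bigr => i ik /=.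
  by rewrite (bigD1 k) //= Ake.
rewrite gammaE -/beta -/N.
have -> : A k k = t + h by rewrite subrK.
by rewrite /mu; field; rewrite ?Nneq0 ?N1neq0.
Qed.

Let D := deviation n h S.

Let beta_ge0 : 0 <= beta.
Proof. by apply: sumr_ge0 => j _; rewrite sqr_ge0. Qed.

Let gamma_ge0 : 0 <= gamma.
Proof.
by apply: sumr_ge0 => i _; apply: sumr_ge0 => j _; rewrite sqr_ge0.
Qed.

(** Ensures that the radicand of [deviation] is nonnegative. *)
Lemma sqr_norm_ge_trace : n%:R * h ^+ 2 <= S.
Proof.
have t2 : 0 <= N / (N - 1) * t ^+ 2.
  by rewrite mulr_ge0 ?sqr_ge0 // divr_ge0 //; have := N2; lra.
by rewrite SE -/N; have := beta_ge0; have := gamma_ge0; lra.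
Qed.

Let sqr_D : D ^+ 2 = N * (S - N * h ^+ 2) / (N - 1).
Proof.
rewrite sqr_sqrtr // divr_ge0 //; last by rewrite -/N; have := N2; rewrite -/N; lra.
by rewrite mulr_ge0 // subr_ge0 sqr_norm_ge_trace.
Qed.

Let t_le : `|t| <= (N - 1) / N * D.
Proof.
have D0 : 0 <= D by rewrite sqrtr_ge0.
rewrite -(@ler_pXn2r _ 2) ?nnegrE // ; last first.
  by rewrite mulr_ge0 // divr_ge0 //; have := N2; rewrite -/N; lra.
rewrite real_normK ?num_real // exprMn sqr_D SE -/N.
rewrite -subr_ge0.
set E := (X in 0 <= X).
have -> : E = (N - 1) / N * (2 * beta + gamma).
  by rewrite /E; field; rewrite ?Nneq0 ?N1neq0.
by rewrite mulr_ge0 ?addr_ge0 ?divr_ge0 ?mulr_ge0 //; have := N2; rewrite -/N; lra.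
Qed.

Let bound := calH n `|h| S.
Let term := A k k * (\sum_(j < n | j != k) A j j) - beta.

(** The three summands are nonnegative; the estimate and its equality cases
    are read off from this formula. *)
Let defect : term - bound =
  (N - 2) * (t * h + (N - 1) / N * (`|h| * D)) + (N - 2) / N * beta
  + (N - 1) / N * gamma.
Proof.
have -> : bound = (N - 1) / N * (2 * N * h ^+ 2 - S - (N - 2) * `|h| * D).
  rewrite /bound /calH -/N /deviation -/N real_normK ?num_real //.
rewrite /term trE SE -/N.
have -> : A k k = t + h by rewrite subrK.
by rewrite /mu; field; rewrite ?Nneq0 ?N1neq0.
Qed.

Let cross_ge0 : 0 <= t * h + (N - 1) / N * (`|h| * D).
Proof.
have : `|t * h| <= (N - 1) / N * D * `|h| by rewrite normrM ler_wpM2r.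
by have := ler_norm (- (t * h)); rewrite normrN; have := N2; rewrite -/N; lra.
Qed.

Lemma quasi_umbilical_estimate : bound <= term.
Proof.
rewrite -subr_ge0 defect; apply: addr_ge0; last first.
  by rewrite mulr_ge0 // divr_ge0 //; have := N2; rewrite -/N; lra.
apply: addr_ge0; first by rewrite mulr_ge0 //; have := N2; rewrite -/N; lra.
by rewrite mulr_ge0 // divr_ge0 //; have := N2; rewrite -/N; lra.
Qed.

(** In dimension 2 the complementary block has a single entry, so [gamma] is 0,
    and the other two summands of [defect] carry the factor [N - 2]. *)
Lemma quasi_umbilical_dim2 : n = 2%N -> term = bound.
Proof.
move=> n2; apply/eqP; rewrite -subr_eq0 defect.
have N_2 : N = 2 by rewrite /N n2.
suff -> : gamma = 0 by rewrite N_2 !subrr !mul0r mulr0 !addr0.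
have trE1 := trE; rewrite N_2 in trE1.
(* Three distinct indices do not fit into two places. *)
have U i j : i != k -> j != k -> i = j.
  move=> ik jk; apply/eqP/negPn/negP => ij.
  have u : uniq [:: k; i; j] by rewrite /= !inE negb_or ![k == _]eq_sym ik jk ij.
  have := uniq_leq_size u (fun l _ => mem_enum 'I_n l).
  by rewrite size_enum_ord [X in (_ <= X)%N]n2.
rewrite /gamma big1 // => i ik; rewrite big1 // => j jk.
have := trE1; rewrite (bigD1 i) //= big1; last first.
  by move=> l /andP[lk]; rewrite (U l i lk ik) eqxx.
rewrite (U j i jk ik) eqxx mulr1n addr0 => ->.
by rewrite -[X in (X - _)]/((1 + 1 - 1) * mu) addrK mul1r subrr expr0n.
Qed.

(** When all three summands of [defect] vanish, [beta] and [gamma] make [A]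
    diagonal with equal entries off [k], and the first one fixes the sign of
    [t] relative to [h], hence [eps]; if [h = 0] both signs are possible. *)
Lemma quasi_umbilical_equality : (2 < n)%N ->
  term = bound <-> exists2 eps, is_sign eps h &
    forall i j, A i j =
      if i == j then if i == k then lambda_ev n eps h S else mu_ev n eps h S
      else 0.
Proof.
move=> n3; have N3 : 3 <= N by rewrite ler_nat.
have DE : Num.sqrt ((n%:R * S - n%:R ^+ 2 * h ^+ 2) / (n%:R - 1)) = D.
  by rewrite /D /deviation; congr (Num.sqrt (_ / _)); ring.
rewrite /lambda_ev /mu_ev DE -/N.
have D0 : 0 <= D by rewrite sqrtr_ge0.
split=> [E|[eps seps Aform]].
  have /eqP := defect; rewrite E subrr eq_sym.
  have c1 : 0 <= (N - 2) * (t * h + (N - 1) / N * (`|h| * D)).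
    by rewrite mulr_ge0 //; have := N2; rewrite -/N; lra.
  have c2 : 0 <= (N - 2) / N * beta.
    by rewrite mulr_ge0 // divr_ge0 //; have := N2; rewrite -/N; lra.
  have c3 : 0 <= (N - 1) / N * gamma.
    by rewrite mulr_ge0 // divr_ge0 //; have := N2; rewrite -/N; lra.
  rewrite paddr_eq0 ?addr_ge0 // paddr_eq0 // -andbA => /and3P[].
  rewrite !mulf_eq0 !invr_eq0.
  have /gt_eqF -> : 0 < N - 2 by lra.
  have /gt_eqF -> : 0 < N - 1 by lra.
  have /gt_eqF -> : 0 < N by lra.
  move=> /= cross0 /eqP beta0 /eqP gamma0.
  have Akj j : j != k -> A k j = 0.
    move=> jk; move/eqP: beta0; rewrite psumr_eq0; last first.
      by move=> *; rewrite sqr_ge0.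
    move=> /allP /(_ j (mem_index_enum j)); rewrite jk /= sqrf_eq0.
    by move/eqP.
  have Aij i j : i != k -> j != k -> A i j = mu *+ (i == j).
    move=> ik jk; move/eqP: gamma0; rewrite psumr_eq0; last first.
      by move=> l _; apply: sumr_ge0 => *; rewrite sqr_ge0.
    move=> /allP /(_ i (mem_index_enum i)); rewrite ik /= psumr_eq0; last first.
      by move=> *; rewrite sqr_ge0.
    move=> /allP /(_ j (mem_index_enum j)); rewrite jk /= sqrf_eq0 subr_eq0.
    by move/eqP.
  have tD : `|t| = (N - 1) / N * D.
    apply/eqP; rewrite -(@eqrXn2 _ 2) //; last first.
      by rewrite mulr_ge0 // divr_ge0 //; have := N2; rewrite -/N; lra.
    rewrite real_normK ?num_real // exprMn sqr_D SE -/N beta0 gamma0.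
    by apply/eqP; field; rewrite ?Nneq0 ?N1neq0.
  (* For [h = 0] the sign opposite to that of [t] is taken. *)
  have [eps seps tE] : exists2 eps, is_sign eps h & t = - ((N - 1) / N * eps * D).
    have [h0|h0] := eqVneq h 0.
      have [t0|t0] := lerP 0 t.
        exists (-1); last by rewrite mulrN1 mulNr opprK -tD ger0_norm.
        by split=> [/eqP|_] //; right.
      exists 1; last by rewrite mulr1 -tD ltr0_norm ?opprK.
      by split=> [/eqP|_] //; left.
    exists (Num.sg h); first by split=> // /eqP; rewrite (negbTE h0).
    apply: (mulIf h0); move: cross0; rewrite addr_eq0 => /eqP ->.
    by rewrite normrEsg; ring.
  exists eps => // i j.
  have [->|ik] := eqVneq i k.
    have [<-|kj] := eqVneq k j; last by rewrite Akj // eq_sym.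
    by rewrite -tE /t; ring.
  have [->|jk] := eqVneq j k.
    rewrite (negbTE ik); have := Asym => /(congr1 (fun B : 'M[R]_n => B k i)).
    by rewrite mxE => ->; rewrite Akj.
  rewrite Aij //; case: eqP => // _; rewrite mulr1n /mu tE.
  by field; rewrite ?Nneq0 ?N1neq0.
have tE : t = - ((N - 1) / N * eps * D).
  by rewrite /t Aform !eqxx; ring.
have beta0 : beta = 0.
  rewrite /beta big1 // => j jk; rewrite Aform eq_sym (negbTE jk).
  by rewrite expr0n.
have gamma0 : gamma = 0.
  rewrite /gamma big1 // => i ik; rewrite big1 // => j jk.
  rewrite Aform (negbTE ik); case: eqP => _; last by rewrite subrr expr0n.
  rewrite mulr1n /mu tE (_ : _ - _ = 0) ?expr0n //.
  by field; rewrite ?Nneq0 ?N1neq0.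
apply/eqP; rewrite -subr_eq0 defect beta0 gamma0 !mulr0 !addr0 tE.
have -> : `|h| = eps * h.
  have [h0|h0] := eqVneq h 0; first by rewrite h0 normr0 mulr0.
  by rewrite seps.1 // normrEsg.
by apply/eqP; ring.
Qed.

End Estimate.

(** * Summation over the normal directions *)

Section NormalDirections.
Context {R : realType} {n : nat} {I : finType}.
Variables (A : I -> 'M[R]_n) (k : 'I_n).
Hypotheses (hn : (2 <= n)%N) (Asym : forall al, (A al)^T = A al).

Let h al := n%:R^-1 * \tr (A al).
Let S al := \sum_i \sum_j A al i j ^+ 2.
Let D al := deviation n (h al) (S al).
Let normH := Num.sqrt (\sum_al h al ^+ 2).
Let T := \sum_al S al.
Let term al := A al k k * (\sum_(j < n | j != k) A al j j)
               - \sum_(j < n | j != k) A al k j ^+ 2.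

Let N2 : 2 <= n%:R :> R. Proof. by rewrite ler_nat. Qed.

Let sqr_normH : normH ^+ 2 = \sum_al h al ^+ 2.
Proof. by rewrite sqr_sqrtr // sumr_ge0 // => al _; rewrite sqr_ge0. Qed.

Let normHE : normH = Num.sqrt (\sum_al `|h al| ^+ 2).
Proof.
by congr Num.sqrt; apply: eq_bigr => al _; rewrite real_normK ?num_real.
Qed.

(** The square of [deviation] is linear in (S, h^2), so it adds up over the
    normal directions; this brings the sum into Cauchy-Schwarz form. *)
Let deviationE : deviation n normH T = Num.sqrt (\sum_al D al ^+ 2).
Proof.
have N1 : 0 <= n%:R - 1 :> R by have := N2; lra.
congr Num.sqrt; rewrite sqr_normH mulr_sumr -sumrB mulr_sumr mulr_suml.
apply: eq_bigr => al _; rewrite sqr_sqrtr // divr_ge0 // mulr_ge0 // subr_ge0.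
exact: sqr_norm_ge_trace.
Qed.

Lemma sum_norm_deviation_le :
  \sum_al `|h al| * D al <= normH * deviation n normH T.
Proof.
by rewrite deviationE normHE; exact: cauchy_schwarz.
Qed.

Let sum_norm_deviation_eq :
  \sum_al `|h al| * D al = normH * deviation n normH T <->
  (normH != 0 -> exists2 rho, 0 <= rho & forall al, D al = rho * `|h al|).
Proof.
by rewrite deviationE normHE; exact: cauchy_schwarz_eq.
Qed.

(** Both summands are nonnegative: the first by the estimate in each
    direction, the second by Cauchy-Schwarz. *)
Let defect : \sum_al term al - calH n normH T =
  \sum_al (term al - calH n `|h al| (S al)) +
  (n%:R - 1) / n%:R * (n%:R - 2) *
    (normH * deviation n normH T - \sum_al `|h al| * D al).
Proof.
have E al : calH n `|h al| (S al) = (n%:R - 1) / n%:R *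
    (2 * n%:R * h al ^+ 2 - S al - (n%:R - 2) * (`|h al| * D al)).
  by rewrite /calH /D /deviation real_normK ?num_real //; ring.
rewrite [X in _ = X + _]sumrB (eq_bigr _ (fun al _ => E al)).
move: (\sum_al term al) => t; rewrite -mulr_sumr !sumrB -!mulr_sumr.
rewrite -sqr_normH -/T /calH; move: (\sum_al _ * D al) (deviation _ _ _) => x d.
by move: T normH ((_ - 1) / _) => *; ring.
Qed.

Let term_ge al : 0 <= term al - calH n `|h al| (S al).
Proof. by rewrite subr_ge0; exact: quasi_umbilical_estimate. Qed.

Let dev_ge : 0 <= (n%:R - 1) / n%:R * (n%:R - 2) *
    (normH * deviation n normH T - \sum_al `|h al| * D al).
Proof.
have n2 := N2; rewrite mulr_ge0 ?subr_ge0 ?sum_norm_deviation_le //.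
by rewrite mulr_ge0 ?divr_ge0 //; lra.
Qed.

Lemma sum_quasi_umbilical_estimate : calH n normH T <= \sum_al term al.
Proof.
by rewrite -subr_ge0 defect addr_ge0 // sumr_ge0.
Qed.

Lemma sum_quasi_umbilical_dim2 : n = 2%N -> \sum_al term al = calH n normH T.
Proof.
move=> n2; apply/eqP; rewrite -subr_eq0 defect big1 => [|al _].
  have -> : n%:R - 2 = 0 :> R by rewrite n2 subrr.
  by rewrite mulr0 mul0r addr0.
by rewrite /term quasi_umbilical_dim2 // subrr.
Qed.

Lemma sum_quasi_umbilical_equality : (2 < n)%N ->
  \sum_al term al = calH n normH T <->
  (forall al, exists2 eps, is_sign eps (h al) &
    forall i j, A al i j =
      if i == j then
        if i == k then lambda_ev n eps (h al) (S al) else mu_ev n eps (h al) (S al)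
      else 0) /\
  (normH != 0 -> exists2 rho, 0 <= rho & forall al, D al = rho * `|h al|).
Proof.
move=> n3; have N3 : 3 <= n%:R :> R by rewrite ler_nat.
have c0 : (n%:R - 1) / n%:R * (n%:R - 2) != 0 :> R.
  by rewrite !mulf_neq0 ?invr_eq0 ?gt_eqF //; lra.
rewrite -sum_norm_deviation_eq; split=> [E|[E1 E2]].
  have /eqP := defect; rewrite E subrr eq_sym paddr_eq0 ?sumr_ge0 //.
  rewrite psumr_eq0 // => /andP[/allP t0]; rewrite mulf_eq0 (negbTE c0) /= => d0.
  split; last by apply/eqP; rewrite eq_sym -subr_eq0.
  move=> al; apply/(quasi_umbilical_equality k hn (Asym al) n3).
  by apply/eqP; rewrite -subr_eq0; apply: t0 (mem_index_enum al).
apply/eqP; rewrite -subr_eq0 defect E2 subrr mulr0 addr0 big1 // => al _.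
apply/eqP; rewrite subr_eq0; apply/eqP.
exact: ((quasi_umbilical_equality k hn (Asym al) n3).2 (E1 al)).
Qed.

End NormalDirections.

(** * Differentiation of matrix-valued maps *)

Section Calculus.
Context {R : realType} {V : normedModType R}.

(** The difference of two maps that agree near [x] has differential 0. *)
Lemma near_eq_differentiable {W : normedModType R} (f g : V -> W) x :
  (\near x, f x = g x) -> differentiable f x -> differentiable g x.
Proof.
move=> fg df.
have [d0 hE] : continuous (\0 : V -> W) /\
    (g - f) \o shift x = cst ((g - f) x) + \0 +o_ 0 id.
  split; first exact: cst_continuous.
  apply/eqaddoP => e e0.
  have : \forall h \near (0 : V), g (h + x) = f (h + x).
    by move: fg; rewrite (near_shift 0) subr0; apply: filterS => h /= ->.
  apply: filterS => h hE.
  rewrite !fctE /= hE (nbhs_singleton fg) !subrr addr0 subrr normr0.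
  by rewrite mulr_ge0 // ltW.
have dgf : differentiable (g - f) x.
  apply/diff_locallyP; split.
    by rewrite (diff_unique d0 hE).
  by rewrite (diff_unique d0 hE).
have -> : g = (g - f) + f by rewrite subrK.
exact: differentiableD.
Unshelve. all: by end_near. Qed.

Lemma differentiable_bigsum {W : normedModType R} (I : finType) (P : pred I)
    (f : I -> V -> W) x :
  (forall i, P i -> differentiable (f i) x) ->
  differentiable (fun y => \sum_(i | P i) f i y) x.
Proof.
move=> df; have -> : (fun y => \sum_(i | P i) f i y) = \sum_(i | P i) f i.
  by apply/funext => y; rewrite fct_sumE.
elim/big_ind: _ => [|g h dg dh|i Pi]; last exact: df.
  exact: differentiable_cst.
exact: differentiableD.
Qed.

Lemma differentiable_bigprod (I : finType) (f : I -> V -> R) x :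
  (forall i, differentiable (f i) x) ->
  differentiable (fun y => \prod_i f i y) x.
Proof.
move=> df; have -> : (fun y => \prod_i f i y) = \prod_i f i.
  by apply/funext => y; rewrite fct_prodE.
elim/big_ind: _ => [|g h dg dh|i _]; last exact: df.
  exact: differentiable_cst.
exact: differentiableM.
Qed.

Lemma differentiable_mxP m n (M : V -> 'M[R]_(m, n)) x :
  differentiable M x <-> forall i j, differentiable (fun y => M y i j) x.
Proof.
split=> [dM i j|dM].
  exact: (differentiable_comp dM (differentiable_coord (M x) i j)).
have -> : M = fun y => \sum_i \sum_j M y i j *: delta_mx i j.
  by apply/funext => y; rewrite {1}(matrix_sum_delta (M y)).
apply: differentiable_bigsum => i _; apply: differentiable_bigsum => j _.
exact: differentiableZl.
Qed.

Lemma is_derive_mxP m n (M : V -> 'M[R]_(m, n)) x v dM :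
  is_derive x v M dM <-> forall i j, is_derive x v (fun y => M y i j) (dM i j).
Proof.
split=> [[M1 <-] i j|H].
  split; first by move/derivable_mxP: M1.
  by rewrite derive_mx // mxE.
have M1 : derivable M x v by apply/derivable_mxP => i j; case: (H i j).
split=> //; rewrite derive_mx //; apply/matrixP => i j; rewrite mxE.
by case: (H i j).
Qed.

Lemma is_derive_bigsum {W : normedModType R} (I : finType) (P : pred I)
    (f : I -> V -> W) df x v :
  (forall i, P i -> is_derive x v (f i) (df i)) ->
  is_derive x v (fun y => \sum_(i | P i) f i y) (\sum_(i | P i) df i).
Proof.
move=> H; have -> : (fun y => \sum_(i | P i) f i y) = \sum_(i | P i) f i.
  by apply/funext => y; rewrite fct_sumE.
elim/big_ind2: _ => [|g dg h dh|i Pi]; last exact: H.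
  exact: is_derive_cst.
exact: is_deriveD.
Qed.

Lemma differentiable_mulmx m n p (A : V -> 'M[R]_(m, n)) (B : V -> 'M[R]_(n, p)) x :
  differentiable A x -> differentiable B x ->
  differentiable (fun y => A y *m B y) x.
Proof.
move=> /differentiable_mxP dA /differentiable_mxP dB; apply/differentiable_mxP.
move=> i j; rewrite (_ : (fun _ => _) = fun y => \sum_k A y i k * B y k j).
  by apply: differentiable_bigsum => k _; apply: differentiableM.
by apply/funext => y; rewrite mxE.
Qed.

Lemma differentiable_trmx m n (A : V -> 'M[R]_(m, n)) x :
  differentiable A x -> differentiable (fun y => (A y)^T) x.
Proof.
move=> /differentiable_mxP dA; apply/differentiable_mxP => i j.
by rewrite (_ : (fun _ => _) = fun y => A y j i) //; apply/funext => y; rewrite mxE.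
Qed.

Lemma differentiable_det n (A : V -> 'M[R]_n) x :
  differentiable A x -> differentiable (fun y => \det (A y)) x.
Proof.
move=> /differentiable_mxP dA; rewrite /determinant.
apply: differentiable_bigsum => s _.
apply: (@differentiableM _ _ (cst _)) => //.
by apply: differentiable_bigprod => i.
Qed.

(** Cramer's rule makes the inverse a rational function of the entries. *)
Lemma differentiable_invmx n (A : V -> 'M[R]_n) x :
  (\forall y \near x, A y \in unitmx) ->
  differentiable A x -> differentiable (fun y => invmx (A y)) x.
Proof.
move=> Au dA.
apply: (@near_eq_differentiable _ (fun y => (\det (A y))^-1 *: \adj (A y))).
  by near=> y; rewrite /invmx (near Au).
apply/differentiable_mxP => i j.
rewrite (_ : (fun _ => _) = fun y => (\det (A y))^-1 * cofactor (A y) j i);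
  last by apply/funext => y; rewrite !mxE.
apply: (@differentiableM _ _ (fun y => (\det (A y))^-1)).
  apply: differentiableV; first exact: differentiable_det.
  by have := nbhs_singleton Au; rewrite unitmxE unitfE.
apply: (@differentiableM _ _ (cst _)) => //; apply: differentiable_det.
move/differentiable_mxP: dA => dA; apply/differentiable_mxP => k l.
by rewrite (_ : (fun _ => _) = fun y => A y (lift j k) (lift i l)) //;
  apply/funext => y; rewrite !mxE.
Unshelve. all: by end_near. Qed.

Lemma is_derive_mulmx m n p (A : V -> 'M[R]_(m, n)) (B : V -> 'M[R]_(n, p))
    dA dB x v :
  is_derive x v A dA -> is_derive x v B dB ->
  is_derive x v (fun y => A y *m B y) (dA *m B x + A x *m dB).
Proof.
move=> /is_derive_mxP hA /is_derive_mxP hB; apply/is_derive_mxP => i j.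
rewrite (_ : (fun _ => _) = fun y => \sum_k A y i k * B y k j); last first.
  by apply/funext => y; rewrite mxE.
have -> : (dA *m B x + A x *m dB) i j =
    \sum_k (A x i k * dB k j + B x k j * dA i k).
  rewrite !mxE -big_split; apply: eq_bigr => k _ /=.
  by rewrite addrC [B x k j * _]mulrC.
by apply: is_derive_bigsum => k _; exact: (is_deriveM (hA i k) (hB k j)).
Qed.

Lemma is_derive_trmx m n (A : V -> 'M[R]_(m, n)) dA x v :
  is_derive x v A dA -> is_derive x v (fun y => (A y)^T) dA^T.
Proof.
move=> /is_derive_mxP hA; apply/is_derive_mxP => i j.
rewrite (_ : (fun _ => _) = fun y => A y j i) ?mxE //.
by apply/funext => y; rewrite mxE.
Qed.

End Calculus.

(** * Symmetry of second derivatives *)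

Section Young.
Context {R : realType} {V : normedModType R}.

Lemma is_derive_line {W : normedModType R} (f : V -> W) (u p : V) (s : R) :
  derivable f (s *: u + p) u ->
  is_derive s 1 (fun r => f (r *: u + p)) ('D_u f (s *: u + p)).
Proof.
move=> df.
have E : (fun h : R => h^-1 *: (((fun r => f (r *: u + p)) \o shift s) (h *: 1)
      - f (s *: u + p))) =
    (fun h : R => h^-1 *: ((f \o shift (s *: u + p)) (h *: u) - f (s *: u + p))).
  apply/funext => h /=; congr (_ *: (f _ - _)).
  by rewrite scalerDl addrA [h *: 1]mulr1.
by split; rewrite /derivable /derive E.
Qed.

Let second_difference (f : V -> R) (q u v : V) (t : R) : R :=
  f (t *: u + t *: v + q) - f (t *: u + q) - f (t *: v + q) + f q.

(** The second difference is an increment of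
    [s |-> f (q + s u + t v) - f (q + s u)]; by the mean value theorem it is [t]
    times an increment of ['D_u f] in direction [t v], and the differential of
    ['D_u f] at [q] controls that one up to o(t). *)
Let second_difference_limit (f : V -> R) (q u v : V) (e : R) :
  (\near q, differentiable f q) -> differentiable ('D_u f) q -> 0 < e ->
  \forall t \near 0^'+,
    `|second_difference f q u v t - t ^+ 2 * 'D_v ('D_u f) q| <= e * t ^+ 2.
Proof.
move=> df dg e0; set g := 'D_u f; set L := 'd g q.
set K := `|u| + `|v| + 1.
have K0 : 0 < K by rewrite ltr_wpDl // addr_ge0.
have e'0 : 0 < e / (2 * K) by rewrite divr_gt0 // mulr_gt0.
(* The error e/(2K) per unit length is used twice, at distance at most tK. *)
have gL : \forall h \near (0 : V),
    `|g (h + q) - g q - L h| <= e / (2 * K) * `|h|.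
  have /eqaddoP := diff_locally dg.
  move=> /(_ _ e'0); apply: filterS => h.
  by rewrite !fctE /= opprD addrA.
have : \forall h \near (0 : V), differentiable f (h + q) /\
    `|g (h + q) - g q - L h| <= e / (2 * K) * `|h|.
  apply: filterI gL; move: df; rewrite (near_shift 0) subr0.
  exact: filterS.
case/nbhs_ballP => r /= r0 Hr.
have small (s t : R) : 0 <= s -> s <= t -> t < r / K ->
    (forall c : R, 0 <= c -> c <= t -> ball (0 : V) r (s *: u + c *: v)) /\
    (forall c : R, 0 <= c -> c <= t -> `|s *: u + c *: v| <= t * K).
  move=> s0 st tr.
  have B (c : R) : 0 <= c -> c <= t -> `|s *: u + c *: v| <= t * K.
    move=> c0 ct; rewrite (le_trans (ler_normD _ _)) // !normrZ !ger0_norm //.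
    rewrite /K mulrDr mulr1 mulrDr ler_wpDr ?(le_trans s0) //.
    by rewrite lerD // ler_wpM2r.
  split => // c c0 ct; rewrite -ball_normE /ball_ /= sub0r normrN.
  by rewrite (le_lt_trans (B _ c0 ct)) // -ltr_pdivlMr.
near=> t.
have t0 : 0 < t by [].
have tr : t < r / K by near: t; apply: nbhs_right_lt; rewrite divr_gt0.
pose phi s := f (s *: u + (t *: v + q)) - f (s *: u + q).
have dphi (s : R) : 0 <= s -> s <= t ->
   is_derive s 1 phi (g (s *: u + (t *: v + q)) - g (s *: u + q)).
  move=> s0 st; have [sm _] := small s t s0 st tr.
  apply: is_deriveB; apply: is_derive_line; apply: diff_derivable.
    by have [] := Hr _ (sm t (ltW t0) (lexx t)); rewrite addrA.
  by have [] := Hr _ (sm 0 (lexx 0) (ltW t0)); rewrite scale0r addr0.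
have [xi] : exists2 xi, xi \in `]0, t[%R & phi t - phi 0 =
    (g (xi *: u + (t *: v + q)) - g (xi *: u + q)) * (t - 0).
  apply: MVT => // [s|].
    by rewrite in_itv /= => /andP[s0 st]; apply: dphi; exact: ltW.
  apply: derivable_within_continuous => s; rewrite in_itv /= => /andP[s0 st].
  by have [] := dphi s s0 st.
rewrite in_itv /= => /andP[xi0 xit] E.
have -> : second_difference f q u v t = phi t - phi 0.
  rewrite /second_difference /phi scale0r !add0r addrA; ring.
rewrite E subr0 [_ + (_ + q)]addrA.
have [sm nm] := small xi t (ltW xi0) (ltW xit) tr.
have [_ h1] := Hr _ (sm t (ltW t0) (lexx t)).
have [_ h2] := Hr _ (sm 0 (lexx 0) (ltW t0)).
have n1 := nm t (ltW t0) (lexx t).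
have n2 := nm 0 (lexx 0) (ltW t0).
rewrite deriveE // -/L.
have LZ c w : L (c *: w) = c * L w by rewrite linearZ.
move: h1 h2 n2; rewrite scale0r !addr0 [L (_ + _)]linearD !LZ => h1 h2 n2.
set g1 := g _ in h1 *; set g2 := g _ in h2 *.
set Lu := L u in h1 h2; set Lv := L v in h1 *.
have b1 : `|g1 - g q - (xi * Lu + t * Lv)| <= e / 2 * t.
  apply: (le_trans h1); apply: (le_trans (ler_wpM2l (ltW e'0) n1)).
  by rewrite le_eqVlt; apply/orP; left; apply/eqP; field; rewrite gt_eqF.
have b2 : `|g2 - g q - xi * Lu| <= e / 2 * t.
  apply: (le_trans h2); apply: (le_trans (ler_wpM2l (ltW e'0) n2)).
  by rewrite le_eqVlt; apply/orP; left; apply/eqP; field; rewrite gt_eqF.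
have -> : (g1 - g2) * t - t ^+ 2 * Lv = t *
    ((g1 - g q - (xi * Lu + t * Lv)) - (g2 - g q - xi * Lu)) by ring.
rewrite normrM gtr0_norm // expr2 mulrCA ler_pM2l //.
by rewrite (le_trans (ler_normB _ _)) //; lra.
Unshelve. all: by end_near. Qed.

(** Symmetry of second derivatives in the form due to Young: both iterated
    derivatives are the limit of the same second difference quotient, and
    Frechet differentiability of the first derivatives suffices. *)
Lemma derive_comm (f : V -> R) (q u v : V) :
  (\near q, differentiable f q) ->
  differentiable ('D_u f) q -> differentiable ('D_v f) q ->
  'D_v ('D_u f) q = 'D_u ('D_v f) q.
Proof.
move=> df du dv; apply/eqP; rewrite -subr_eq0 -normr_le0.
apply/ler_addgt0Pl => e e0; rewrite addr0.
have e2 : 0 < e / 2 by rewrite divr_gt0.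
have H1 := @second_difference_limit f q u v _ df du e2.
have H2 := @second_difference_limit f q v u _ df dv e2.
near (0 : R)^'+ => t.
have t0 : 0 < t by [].
have [h1 h2] : `|second_difference f q u v t - t ^+ 2 * 'D_v ('D_u f) q|
      <= e / 2 * t ^+ 2 /\
    `|second_difference f q v u t - t ^+ 2 * 'D_u ('D_v f) q|
      <= e / 2 * t ^+ 2.
  by near: t; exact: filterI H1 H2.
have S : second_difference f q v u t = second_difference f q u v t.
  by rewrite /second_difference [t *: v + t *: u]addrC; ring.
rewrite S in h2.
have t2 : 0 < t ^+ 2 by rewrite exprn_gt0.
rewrite -(ler_pM2l t2) -{1}(gtr0_norm t2) -normrM.
move: h1 h2; move: (second_difference _ _ _ _ _) => a.
move: ('D_v ('D_u f) q) ('D_u ('D_v f) q) => A B h1 h2.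
have -> : t ^+ 2 * (A - B) = (a - t ^+ 2 * B) - (a - t ^+ 2 * A) by ring.
rewrite (le_trans (ler_normB _ _)) //.
by have := lerD h2 h1; lra.
Unshelve. all: by end_near. Qed.

End Young.

(** * Smooth maps *)

Section SmoothOn.
Context {R : realType} {V W : normedModType R}.
Variables (U : set V) (f : V -> W).
Hypothesis sf : smooth_on U f.

Lemma smooth_differentiable x : U x -> differentiable f x.
Proof. by move=> Ux; have [/(_ x Ux)] := sf 1. Qed.

Lemma smooth_derive v : smooth_on U ('D_v f).
Proof. by move=> k; have [_ /(_ v)] := sf k.+1. Qed.

End SmoothOn.

Lemma smooth_derive_comm {R : realType} {V : normedModType R} {k l : nat}
    (U : set V) (f : V -> 'M[R]_(k, l)) (x u v : V) :
  open U -> smooth_on U f -> U x ->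
  'D_u ('D_v f) x = 'D_v ('D_u f) x.
Proof.
move=> oU sf Ux.
have nU : \forall y \near x, U y by apply: open_nbhs_nbhs.
have D y a : U y -> derivable f y a.
  by move=> Uy; apply/diff_derivable/(smooth_differentiable sf).
have E a b i j : ('D_a ('D_b f) x) i j = 'D_a ('D_b (fun z => f z i j)) x.
  rewrite derive_mx; last first.
    exact/diff_derivable/(smooth_differentiable (smooth_derive sf b) Ux).
  rewrite mxE; apply: near_eq_derive; near=> y; rewrite derive_mx ?mxE //.
  by apply: D; near: y.
have dD a i j : differentiable ('D_a (fun z => f z i j)) x.
  have /differentiable_mxP := smooth_differentiable (smooth_derive sf a) Ux.
  move=> /(_ i j); apply: near_eq_differentiable; near=> y.
  by rewrite derive_mx ?mxE //; apply: D; near: y.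
apply/matrixP => i j.
have df : \near x, differentiable (fun z => f z i j) x.
  near=> y; have Uy : U y by near: y.
  by have /differentiable_mxP := smooth_differentiable sf Uy; apply.
have H := derive_comm df (dD v i j) (dD u i j).
exact: etrans (E u v i j) (etrans H (esym (E v u i j))).
Unshelve. all: by end_near. Qed.

(** * Bilinear forms and their derivatives *)

Section InnerProduct.
Context {R : realType} {m : nat}.
Implicit Types (G : 'M[R]_m) (u v : 'rV[R]_m).

Lemma ipDl G u u' v : ip G (u + u') v = ip G u v + ip G u' v.
Proof. by rewrite /ip !mulmxDl mxE. Qed.

Lemma ipDr G u v v' : ip G u (v + v') = ip G u v + ip G u v'.
Proof. by rewrite /ip raddfD mulmxDr mxE. Qed.

Lemma ipZl G c u v : ip G (c *: u) v = c * ip G u v.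
Proof. by rewrite /ip -!scalemxAl mxE. Qed.

Lemma ipZr G c u v : ip G u (c *: v) = c * ip G u v.
Proof. by rewrite /ip linearZ /= -scalemxAr mxE. Qed.

Lemma ipNl G u v : ip G (- u) v = - ip G u v.
Proof. by rewrite -scaleN1r ipZl mulN1r. Qed.

Lemma ipBl G u u' v : ip G (u - u') v = ip G u v - ip G u' v.
Proof. by rewrite ipDl ipNl. Qed.

Lemma ipBr G u v v' : ip G u (v - v') = ip G u v - ip G u v'.
Proof. by rewrite ipDr -scaleN1r ipZr mulN1r. Qed.

Lemma ip0l G v : ip G 0 v = 0.
Proof. by rewrite -[0](scale0r (0 : 'rV_m)) ipZl mul0r. Qed.

Lemma ip_suml (I : finType) (P : pred I) G (u : I -> 'rV_m) v :
  ip G (\sum_(i | P i) u i) v = \sum_(i | P i) ip G (u i) v.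
Proof.
by elim/big_rec2: _ => [|i x y _ E]; rewrite ?ip0l // ipDl E.
Qed.

Lemma ipC G u v : G^T = G -> ip G u v = ip G v u.
Proof.
move=> Gs; rewrite /ip; transitivity ((u *m G *m v^T)^T 0 0).
  by rewrite [RHS]mxE.
by rewrite !trmx_mul trmxK Gs mulmxA.
Qed.

Lemma posdef_unitmx G : (forall u, u != 0 -> 0 < ip G u u) -> G \in unitmx.
Proof.
move=> Gp; rewrite -row_free_unit; apply/row_freeP.
suff : kermx G == 0 by rewrite kermx_eq0 => /row_freeP.
apply/rowV0P => u /sub_kermxP uG; apply/eqP/negPn/negP => /Gp.
by rewrite /ip uG mul0mx mxE ltxx.
Qed.

Lemma is_derive_ip {V : normedModType R} (G : V -> 'M[R]_m) (a b : V -> 'rV[R]_m)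
    (x h : V) dG da db :
  is_derive x h G dG -> is_derive x h a da -> is_derive x h b db ->
  is_derive x h (fun y => ip (G y) (a y) (b y))
    (ip dG (a x) (b x) + ip (G x) da (b x) + ip (G x) (a x) db).
Proof.
move=> hG ha hb.
have /is_derive_mxP/(_ 0 0) :=
  is_derive_mulmx (is_derive_mulmx ha hG) (is_derive_trmx hb).
set d := (X in is_derive _ _ _ X); rewrite /ip.
suff -> : d = (a x *m dG *m (b x)^T) 0 0 + (da *m G x *m (b x)^T) 0 0
  + (a x *m G x *m db^T) 0 0 by [].
rewrite /d mulmxDl [LHS]mxE [X in X + _ = _]mxE.
by rewrite [X in X + _ = _]addrC.
Qed.

End InnerProduct.

Section CovPair.
Context {R : realType} {m : nat}.
Implicit Types w v : 'rV[R]_m.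

Lemma covpairE w v : covpair w v = \sum_j w 0 j * v 0 j.
Proof. by rewrite /covpair mxE; apply: eq_bigr => j _; rewrite mxE. Qed.

Lemma covpairDr w v v' : covpair w (v + v') = covpair w v + covpair w v'.
Proof. by rewrite /covpair raddfD mulmxDr mxE. Qed.

Lemma covpairZr w c v : covpair w (c *: v) = c * covpair w v.
Proof. by rewrite /covpair linearZ /= -scalemxAr mxE. Qed.

End CovPair.

(** A connection in coordinates differs from the flat one by a field of
    bilinear maps; [C i j] is the value of such a map on the i-th and j-th
    basis vectors. *)
HB.lock Definition bform (R : realType) (m : nat)
    (C : 'I_m -> 'I_m -> 'rV[R]_m) (a b : 'rV[R]_m) : 'rV[R]_m :=
  \sum_i \sum_j (a 0 i * b 0 j) *: C i j.

Section BilinearForm.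
Context {R : realType} {m : nat}.
Implicit Types (C : 'I_m -> 'I_m -> 'rV[R]_m) (a b : 'rV[R]_m).

Lemma bformDl C a a' b : bform C (a + a') b = bform C a b + bform C a' b.
Proof.
rewrite bform.unlock -big_split; apply: eq_bigr => i _ /=.
rewrite -big_split; apply: eq_bigr => j _ /=.
by rewrite mxE mulrDl scalerDl.
Qed.

Lemma bformDr C a b b' : bform C a (b + b') = bform C a b + bform C a b'.
Proof.
rewrite bform.unlock -big_split; apply: eq_bigr => i _ /=.
rewrite -big_split; apply: eq_bigr => j _ /=.
by rewrite mxE mulrDr scalerDl.
Qed.

Lemma bformZl C k a b : bform C (k *: a) b = k *: bform C a b.
Proof.
rewrite bform.unlock scaler_sumr; apply: eq_bigr => i _ /=.
rewrite scaler_sumr; apply: eq_bigr => j _ /=.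
by rewrite mxE scalerA mulrA.
Qed.

Lemma bformZr C k a b : bform C a (k *: b) = k *: bform C a b.
Proof.
rewrite bform.unlock scaler_sumr; apply: eq_bigr => i _ /=.
rewrite scaler_sumr; apply: eq_bigr => j _ /=.
by rewrite mxE scalerA mulrCA.
Qed.

Lemma bformBr C a b b' : bform C a (b - b') = bform C a b - bform C a b'.
Proof. by rewrite bformDr -scaleN1r bformZr scaleN1r. Qed.

Lemma bform0l C b : bform C 0 b = 0.
Proof. by rewrite -[0](scale0r (0 : 'rV_m)) bformZl !scale0r. Qed.

Lemma is_derive_bform {V : normedModType R} (C : V -> 'I_m -> 'I_m -> 'rV[R]_m)
    (a b : V -> 'rV[R]_m) x v dC da db :
  (forall i j, is_derive x v (fun y => C y i j) (dC i j)) ->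
  is_derive x v a da -> is_derive x v b db ->
  is_derive x v (fun y => bform (C y) (a y) (b y))
    (bform dC (a x) (b x) + bform (C x) da (b x) + bform (C x) (a x) db).
Proof.
move=> hC /is_derive_mxP ha /is_derive_mxP hb.
rewrite bform.unlock -!big_split /=; apply: is_derive_bigsum => i _.
rewrite -!big_split /=; apply: is_derive_bigsum => j _.
apply/is_derive_mxP => k l.
have /is_derive_mxP/(_ k l) hCkl := hC i j.
rewrite (_ : (fun _ => _) = fun y => a y 0 i * b y 0 j * C y i j k l); last first.
  by apply/funext => y; rewrite mxE.
have := is_deriveM (is_deriveM (ha 0 i) (hb 0 j)) hCkl.
set d := (X in is_derive _ _ _ X) => H.
rewrite (_ : _ k l = d) // /d !mxE /GRing.scale /=.
by rewrite !fctE; ring.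
Qed.

Lemma differentiable_bform {V : normedModType R}
    (C : V -> 'I_m -> 'I_m -> 'rV[R]_m) (a b : V -> 'rV[R]_m) x :
  (forall i j, differentiable (fun y => C y i j) x) ->
  differentiable a x -> differentiable b x ->
  differentiable (fun y => bform (C y) (a y) (b y)) x.
Proof.
move=> hC /differentiable_mxP ha /differentiable_mxP hb.
rewrite bform.unlock.
apply: differentiable_bigsum => i _; apply: differentiable_bigsum => j _.
apply/differentiable_mxP => k l.
have /differentiable_mxP/(_ k l) hCkl := hC i j.
rewrite (_ : (fun _ => _) = fun y => a y 0 i * b y 0 j * C y i j k l); last first.
  by apply/funext => y; rewrite mxE.
apply: (@differentiableM _ _ (fun y => a y 0 i * b y 0 j)) => //.
exact: differentiableM.
Qed.

End BilinearForm.

(** * Connections in coordinates *)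

(** These two records carry the hypotheses from the manifolds to open sets of
    coordinate spaces, where all computations take place. *)
Record ambient_chart {R : realType} {m : nat} (G : 'rV[R]_m -> 'M[R]_m)
    (w : 'rV[R]_m -> 'rV[R]_m) (O : set 'rV[R]_m) : Prop := AmbientChart {
  ambient_open : open O;
  ambient_gram_smooth : smooth_on O G;
  ambient_form_smooth : smooth_on O w;
  ambient_gram_sym : forall y, O y -> (G y)^T = G y;
  ambient_gram_pos : forall y, O y -> forall u, u != 0 -> 0 < ip (G y) u u
}.

Record immersed_chart {R : realType} {n m : nat} (F : 'rV[R]_n -> 'rV[R]_m)
    (U : set 'rV[R]_n) (O : set 'rV[R]_m) : Prop := ImmersedChart {
  immersed_open : open U;
  immersed_smooth : smooth_on U F;
  immersed_sub : forall y, U y -> O (F y);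
  immersed_rank : forall y, U y -> row_free (jacobian F y)
}.

Section ConnectionCoefficients.
Context {R : realType} {m : nat}.
Variables (G : 'rV[R]_m -> 'M[R]_m) (w : 'rV[R]_m -> 'rV[R]_m).

Definition lc_coeff y (i j : 'I_m) : 'rV[R]_m := \row_k christoffel G y i j k.

Definition ssnm_coeff y (i j : 'I_m) : 'rV[R]_m :=
  lc_coeff y i j + w y 0 j *: delta_mx 0 i.

Lemma christoffel_formE y a b :
  christoffel_form G y a b = bform (lc_coeff y) a b.
Proof.
apply/rowP => k; rewrite mxE bform.unlock summxE; apply: eq_bigr => i _.
by rewrite summxE; apply: eq_bigr => j _; rewrite !mxE.
Qed.

Lemma ssnm_formE y a b :
  christoffel_form G y a b + covpair (w y) b *: a = bform (ssnm_coeff y) a b.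
Proof.
rewrite christoffel_formE bform.unlock.
have -> : covpair (w y) b *: a =
    \sum_i \sum_j (a 0 i * b 0 j) *: (w y 0 j *: delta_mx 0 i).
  rewrite {1}(row_sum_delta a) scaler_sumr; apply: eq_bigr => i _.
  rewrite covpairE scalerA mulr_suml scaler_suml; apply: eq_bigr => j _.
  by rewrite scalerA; congr (_ *: _); ring.
rewrite -big_split; apply: eq_bigr => i _; rewrite -big_split /=.
by apply: eq_bigr => j _; rewrite -scalerDr.
Qed.

Variable O : set 'rV[R]_m.
Hypothesis amb : ambient_chart G w O.

Let oO := ambient_open amb.
Let sG := ambient_gram_smooth amb.
Let sw := ambient_form_smooth amb.
Let Gsym := ambient_gram_sym amb.
Let Gpos := ambient_gram_pos amb.

Let nearO y : O y -> \forall z \near y, O z.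
Proof. by move=> Oy; apply: open_nbhs_nbhs. Qed.

Lemma gram_unitmx y : O y -> G y \in unitmx.
Proof. by move=> Oy; apply/posdef_unitmx/Gpos. Qed.

Lemma derive_gram_sym y v : O y -> ('D_v G y)^T = 'D_v G y.
Proof.
move=> Oy.
have dG := derivableP
  (@diff_derivable _ _ _ _ _ v (smooth_differentiable sG Oy)).
have [_ <-] := is_derive_trmx dG.
by apply: near_eq_derive; near=> z; apply: Gsym; near: z; exact: nearO.
Unshelve. all: by end_near. Qed.

Lemma differentiable_lc_coeff y i j :
  O y -> differentiable (fun z => lc_coeff z i j) y.
Proof.
move=> Oy; apply/differentiable_mxP => r k.
rewrite (_ : (fun _ => _) = fun z => christoffel G z i j k); last first.
  by apply/funext => z; rewrite mxE.
have dD a s t : differentiable (fun z => 'D_a G z s t) y.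
  by have /differentiable_mxP := smooth_differentiable (smooth_derive sG a) Oy.
apply: (@differentiableM _ _ (cst _)) => //.
apply: differentiable_bigsum => l _.
apply: (@differentiableM _ _ (fun z => invmx (G z) k l)).
  have : differentiable (fun z => invmx (G z)) y.
    apply: differentiable_invmx; last exact: smooth_differentiable Oy.
    by near=> z; apply: gram_unitmx; near: z; exact: nearO.
  by move/differentiable_mxP.
apply: (@differentiableB _ _ _ (fun z => _ + _)) => //.
exact: (@differentiableD _ _ _ (fun z => _)).
Unshelve. all: by end_near. Qed.

Lemma differentiable_ssnm_coeff y i j :
  O y -> differentiable (fun z => ssnm_coeff z i j) y.
Proof.
move=> Oy; apply: (@differentiableD _ _ _ (fun z => lc_coeff z i j)).
  exact: differentiable_lc_coeff.
apply: differentiableZl.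
by have /differentiable_mxP := smooth_differentiable sw Oy.
Qed.

Lemma lc_coeff_form_sym y a b :
  O y -> bform (lc_coeff y) a b = bform (lc_coeff y) b a.
Proof.
move=> Oy; rewrite -!christoffel_formE; apply: christoffel_form_sym => i.
exact: derive_gram_sym.
Qed.

(** Metric compatibility, extended from coordinate fields to arbitrary vectors
    by trilinearity. *)
Lemma ip_derive_gram y a b c : O y ->
  ip ('D_a G y) b c = ip (G y) (bform (lc_coeff y) a b) c
                      + ip (G y) b (bform (lc_coeff y) a c).
Proof.
move=> Oy; have dG := smooth_differentiable sG Oy.
have DE : 'D_a G y = \sum_i a 0 i *: 'D_(delta_mx 0 i) G y.
  rewrite deriveE // {1}(row_sum_delta a) linear_sum; apply: eq_bigr => i _.
  by rewrite linearZ -deriveE.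
have formE u v : ip (G y) (bform (lc_coeff y) a u) v = \sum_i \sum_j \sum_k
    a 0 i * u 0 j * v 0 k * \sum_l christoffel G y i j l * G y l k.
  rewrite bform.unlock ip_suml; apply: eq_bigr => i _; rewrite ip_suml.
  apply: eq_bigr => j _; rewrite ipZl /ip mxE mulr_sumr.
  apply: eq_bigr => k _; rewrite !mxE -[RHS]mulrA; congr (_ * _).
  rewrite mulrC; congr (_ * _).
  by apply: eq_bigr => l _; rewrite mxE.
have key i j k : 'D_(delta_mx 0 i) G y j k =
    \sum_l christoffel G y i j l * G y l k +
    \sum_l christoffel G y i k l * G y l j.
  have -> : \sum_l christoffel G y i k l * G y l j =
            \sum_l christoffel G y i k l * G y j l.
    by apply: eq_bigr => l _; rewrite -{1}(Gsym Oy) mxE.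
  apply: levi_civita_metric; first exact: gram_unitmx.
    exact: Gsym.
  by move=> l; exact: derive_gram_sym.
rewrite [X in _ = _ + X]ipC ?Gsym // !formE DE.
transitivity (\sum_i \sum_j \sum_k
    a 0 i * b 0 j * c 0 k * 'D_(delta_mx 0 i) G y j k).
  rewrite /ip mulmx_sumr mulmx_suml summxE; apply: eq_bigr => i _.
  rewrite -mulmxA mxE; apply: eq_bigr => j _; rewrite mxE mulr_sumr.
  by apply: eq_bigr => k _; rewrite !mxE; ring.
rewrite -big_split; apply: eq_bigr => i _ /=.
rewrite [X in _ = _ + X]exchange_big -big_split; apply: eq_bigr => j _ /=.
by rewrite -big_split; apply: eq_bigr => k _ /=; rewrite key; ring.
Qed.

End ConnectionCoefficients.

(** * Curvature *)

Section Curvature.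
Context {R : realType} {m : nat}.

(** The curvature of the connection with coefficients [C], evaluated on fields
    with constant components, for which the Lie bracket vanishes. *)
Definition coeff_curvature (C : 'rV[R]_m -> 'I_m -> 'I_m -> 'rV[R]_m)
    (y a b c : 'rV[R]_m) : 'rV[R]_m :=
  ('D_a (fun z => bform (C z) b c) y - 'D_b (fun z => bform (C z) a c) y)
  + (bform (C y) a (bform (C y) b c) - bform (C y) b (bform (C y) a c)).

Lemma lie_cst (a b : 'rV[R]_m) : lie (cst a) (cst b) = cst 0.
Proof. by apply/funext => y; rewrite /lie !derive_cst subrr. Qed.

Lemma levi_civita_cst (G : 'rV[R]_m -> 'M[R]_m) a b y :
  levi_civita G (cst a) (cst b) y = bform (lc_coeff G y) a b.
Proof. by rewrite /levi_civita derive_cst add0r christoffel_formE. Qed.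

Lemma curvature_levi_civita (G : 'rV[R]_m -> 'M[R]_m) a b c y :
  curvature (levi_civita G) (cst a) (cst b) (cst c) y =
  coeff_curvature (lc_coeff G) y a b c.
Proof.
have E u v : levi_civita G (cst u) (cst v) = fun z => bform (lc_coeff G z) u v.
  by apply/funext => z; exact: levi_civita_cst.
have Z : levi_civita G (cst 0) (cst c) y = 0 by rewrite levi_civita_cst bform0l.
rewrite /curvature lie_cst [X in _ - X]Z subr0 E (E a c).
rewrite /levi_civita !christoffel_formE /coeff_curvature opprD addrACA.
by [].
Qed.

Section Ambient.
Variables (G : 'rV[R]_m -> 'M[R]_m) (w : 'rV[R]_m -> 'rV[R]_m).
Variable O : set 'rV[R]_m.
Hypothesis amb : ambient_chart G w O.

Let oO := ambient_open amb.
Let sG := ambient_gram_smooth amb.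
Let sw := ambient_form_smooth amb.
Let Gsym := ambient_gram_sym amb.
Let Gpos := ambient_gram_pos amb.

(** The terms phi(Z) phi(Y) X and (nabla_X phi)(Z) Y survive the
    antisymmetrization; phi(Z) nabla_X Y cancels because the Levi-Civita
    connection is torsion free. *)
Lemma coeff_curvature_ssnm y a b c : O y ->
  coeff_curvature (ssnm_coeff G w) y a b c =
  coeff_curvature (lc_coeff G) y a b c
    + (s_tensor G w y a c *: b - s_tensor G w y b c *: a).
Proof.
move=> Oy.
have D u v : 'D_u (fun z => bform (ssnm_coeff G w z) v c) y =
    'D_u (fun z => bform (lc_coeff G z) v c) y
    + 'D_u (fun z => covpair (w z) c) y *: v.
  rewrite (_ : (fun z => bform (ssnm_coeff G w z) v c) =
      (fun z => bform (lc_coeff G z) v c) + (fun z => covpair (w z) c *: v));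
    last by apply/funext => z; rewrite -ssnm_formE christoffel_formE.
  have dw : differentiable (fun z => covpair (w z) c) y.
    rewrite /covpair.
    have /differentiable_mxP : differentiable (fun z => w z *m c^T) y.
      apply: (@differentiable_mulmx _ _ _ _ _ _ (cst _)) => //.
      exact: smooth_differentiable Oy.
    by apply.
  rewrite deriveD; last 2 first.
  - apply/diff_derivable/(@differentiable_bform _ _ _ _ (cst v) (cst c)) => //.
    by move=> i j; apply: (differentiable_lc_coeff amb).
  - exact/diff_derivable/differentiableZl.
  congr (_ + _); rewrite deriveE; last exact: differentiableZl.
  by rewrite diffZl // -deriveE.
rewrite /coeff_curvature !D -!ssnm_formE !christoffel_formE /s_tensor /s_field.
rewrite (levi_civita_cst G a c) (levi_civita_cst G b c) /cst.
set d1 := 'D_a (fun z => covpair (w z) c) y.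
set d2 := 'D_b (fun z => covpair (w z) c) y.
move: d1 d2 ('D_a (fun z => bform (lc_coeff G z) b c) y)
  ('D_b (fun z => bform (lc_coeff G z) a c) y) => d1 d2 d3 d4.
have Lsym := lc_coeff_form_sym amb b a Oy.
move: (lc_coeff G y) (covpair (w y) c) Lsym => L wc Lsym.
rewrite (covpairDr _ (bform L b c) (wc *: b)).
rewrite (covpairDr _ (bform L a c) (wc *: a)).
rewrite (bformDr L a (bform L b c) (wc *: b)).
rewrite (bformDr L b (bform L a c) (wc *: a)).
rewrite (bformZr L wc a b) (bformZr L wc b a).
rewrite (covpairZr (w y) wc a) (covpairZr (w y) wc b).
rewrite Lsym.
move: (covpair (w y) a) (covpair (w y) b) => wa wb.
move: (covpair _ (bform L a c)) (covpair _ (bform L b c)) => p r.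
move: (bform L a b) (bform L a (bform L b c)) (bform L b (bform L a c)) => X Y Z.
by apply/rowP => k; rewrite !mxE; ring.
Qed.

End Ambient.

(** Pulling back a connection pulls back its curvature: second derivatives of
    [F] and of [V] cancel by symmetry. *)
Lemma curvature_along {n : nat} (C : 'rV[R]_m -> 'I_m -> 'I_m -> 'rV[R]_m)
    (F V : 'rV[R]_n -> 'rV[R]_m) (q u v : 'rV[R]_n) :
  let cov a (Y : 'rV[R]_n -> 'rV[R]_m) y :=
    'D_a Y y + bform (C (F y)) ('D_a F y) (Y y) in
  (forall i j, differentiable (fun z => C z i j) (F q)) ->
  differentiable F q -> differentiable V q ->
  (forall a, differentiable ('D_a F) q) -> (forall a, differentiable ('D_a V) q) ->
  'D_u ('D_v F) q = 'D_v ('D_u F) q -> 'D_u ('D_v V) q = 'D_v ('D_u V) q ->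
  cov u (cov v V) q - cov v (cov u V) q =
    coeff_curvature C (F q) ('D_u F q) ('D_v F q) (V q).
Proof.
move=> cov dC dF dV dDF dDV symF symV.
have dCF a i j : is_derive q a (fun y => C (F y) i j)
    ('D_('D_a F q) (fun z => C z i j) (F q)).
  have d := differentiable_comp dF (dC i j).
  have -> : 'D_('D_a F q) (fun z => C z i j) (F q) =
            'D_a ((fun z => C z i j) \o F) q.
    by rewrite (deriveE _ d) (diff_comp dF (dC i j)) /= !deriveE.
  exact/derivableP/diff_derivable.
have dB a b c : 'D_a (fun z => bform (C z) b c) (F q) =
    bform (fun i j => 'D_a (fun z => C z i j) (F q)) b c.
  have h i j := derivableP (@diff_derivable _ _ _ _ _ a (dC i j)).
  have := is_derive_bform h (is_derive_cst b (F q) a) (is_derive_cst c (F q) a).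
  by case=> _ ->; rewrite bform0l addr0 -[X in _ + bform _ _ X](scale0r (0 : 'rV_m))
    bformZr scale0r addr0.
have dcov a b : 'D_a (cov b V) q = 'D_a ('D_b V) q +
    ('D_('D_a F q) (fun z => bform (C z) ('D_b F q) (V q)) (F q)
     + bform (C (F q)) ('D_a ('D_b F) q) (V q)
     + bform (C (F q)) ('D_b F q) ('D_a V q)).
  have h1 := derivableP (@diff_derivable _ _ _ _ _ a (dDV b)).
  have h2 := derivableP (@diff_derivable _ _ _ _ _ a (dDF b)).
  have h3 := derivableP (@diff_derivable _ _ _ _ _ a dV).
  by have [_ ->] := is_deriveD h1 (is_derive_bform (dCF a) h2 h3); rewrite dB.
have covE a b X Y : 'D_a ('D_b V) q = X -> 'D_a ('D_b F) q = Y ->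
    cov a (cov b V) q = X +
      ('D_('D_a F q) (fun z => bform (C z) ('D_b F q) (V q)) (F q)
       + bform (C (F q)) Y (V q) + bform (C (F q)) ('D_b F q) ('D_a V q))
      + (bform (C (F q)) ('D_a F q) ('D_b V q)
         + bform (C (F q)) ('D_a F q) (bform (C (F q)) ('D_b F q) (V q))).
  by move=> <- <-; exact: (congr2 +%R (dcov a b) (bformDr _ _ _ _)).
rewrite /coeff_curvature.
apply: (etrans (congr2 (fun x y : 'rV[R]_m => x - y)
  (covE u v _ _ symV symF) (covE v u _ _ erefl erefl))).
move: ('D_v ('D_u V) q) ('D_v ('D_u F) q) => X Y.
move: ('D_('D_u F q) _ _) ('D_('D_v F q) _ _) => S T.
move: ('D_u F q) ('D_v F q) ('D_u V q) ('D_v V q) => Fu Fv Vu Vv.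
move: (bform _ Y _) (bform _ Fu (bform _ _ _)) (bform _ Fv (bform _ _ _)).
move: (bform _ Fu Vv) (bform _ Fv Vu) => P Q A B D.
by apply/rowP => k; rewrite !mxE; ring.
Qed.

End Curvature.

(** * The Gauss equation *)

Section Gauss.
Context {R : realType} {n m : nat}.
Variables (G : 'rV[R]_m -> 'M[R]_m) (w : 'rV[R]_m -> 'rV[R]_m).
Variable F : 'rV[R]_n -> 'rV[R]_m.

Lemma ip_ind_metric y u v :
  ip (ind_metric G F y) u v = ip (G (F y)) (push F y u) (push F y v).
Proof. by rewrite /ip /ind_metric /push trmx_mul !mulmxA. Qed.

Lemma tan_partD y v v' :
  tan_part G F y (v + v') = tan_part G F y v + tan_part G F y v'.
Proof. by rewrite /tan_part !mulmxDl. Qed.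

Lemma tan_partZ y k v : tan_part G F y (k *: v) = k *: tan_part G F y v.
Proof. by rewrite /tan_part -!scalemxAl. Qed.

Lemma pushD y u u' : push F y (u + u') = push F y u + push F y u'.
Proof. by rewrite /push mulmxDl. Qed.

Lemma pushZ y k u : push F y (k *: u) = k *: push F y u.
Proof. by rewrite /push -scalemxAl. Qed.

Lemma nor_partD y v v' :
  nor_part G F y (v + v') = nor_part G F y v + nor_part G F y v'.
Proof. by rewrite /nor_part tan_partD pushD opprD addrACA. Qed.

Lemma nor_partZ y k v : nor_part G F y (k *: v) = k *: nor_part G F y v.
Proof. by rewrite /nor_part tan_partZ pushZ scalerBr. Qed.

Lemma ssnm_along_cst u (Y : 'rV[R]_n -> 'rV[R]_m) y :
  ssnm_along G w F (cst u) Y y =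
  'D_u Y y + bform (ssnm_coeff G w (F y)) (push F y u) (Y y).
Proof. by rewrite -ssnm_formE addrA. Qed.

Section AtUnit.
Variable y : 'rV[R]_n.
Hypothesis Iu : ind_metric G F y \in unitmx.

Lemma ip_tan_part v t :
  ip (ind_metric G F y) (tan_part G F y v) t = ip (G (F y)) v (push F y t).
Proof.
by rewrite /ip /tan_part mulmxKV // /push trmx_mul !mulmxA.
Qed.

Lemma nor_part_push u : nor_part G F y (push F y u) = 0.
Proof.
rewrite /nor_part /tan_part /push.
have -> : u *m jacobian F y *m G (F y) *m (jacobian F y)^T =
          u *m ind_metric G F y by rewrite /ind_metric !mulmxA.
by rewrite mulmxK // subrr.
Qed.

End AtUnit.

Variables (U : set 'rV[R]_n) (O : set 'rV[R]_m).
Hypotheses (amb : ambient_chart G w O) (imm : immersed_chart F U O).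

Let sG := ambient_gram_smooth amb.
Let Gpos := ambient_gram_pos amb.
Let oU := immersed_open imm.
Let sF := immersed_smooth imm.
Let FO := immersed_sub imm.
Let Jfree := immersed_rank imm.

Let nearU y : U y -> \forall z \near y, U z.
Proof. by move=> Uy; apply: open_nbhs_nbhs. Qed.

Let dF y : U y -> differentiable F y.
Proof. exact: smooth_differentiable. Qed.

Let dDF v y : U y -> differentiable ('D_v F) y.
Proof. by move=> Uy; exact: (smooth_differentiable (smooth_derive sF v) Uy). Qed.

Lemma pushE y v : U y -> push F y v = 'D_v F y.
Proof. by move=> Uy; rewrite /push deriveEjacobian //; exact: dF. Qed.

Lemma ind_metric_unitmx y : U y -> ind_metric G F y \in unitmx.
Proof.
move=> Uy; apply: posdef_unitmx => u u0; rewrite ip_ind_metric.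
apply: Gpos; first exact: FO.
apply: contra_neq u0 => uJ; apply: (row_free_inj (Jfree Uy)).
by rewrite mul0mx -[LHS]/(push F y u) uJ.
Qed.

Lemma differentiable_jacobian y : U y -> differentiable (jacobian F) y.
Proof.
move=> Uy; apply/differentiable_mxP => i j.
apply: (@near_eq_differentiable _ _ _ (fun z => 'D_(delta_mx 0 i) F z 0 j)).
  near=> z; have Uz : U z by near: z; exact: nearU.
  by rewrite -pushE // /push -rowE mxE.
by have /differentiable_mxP := dDF (delta_mx 0 i) Uy; apply.
Unshelve. all: by end_near. Qed.

Lemma differentiable_tan_part V y :
  U y -> differentiable V y -> differentiable (fun z => tan_part G F z (V z)) y.
Proof.
move=> Uy dV.
have dJ := differentiable_jacobian Uy.
have dJT := differentiable_trmx dJ.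
have dG : differentiable (fun z => G (F z)) y.
  exact: (differentiable_comp (dF Uy) (smooth_differentiable sG (FO Uy))).
have dI : differentiable (ind_metric G F) y.
  by apply: differentiable_mulmx => //; exact: differentiable_mulmx.
apply: differentiable_mulmx.
  by apply: differentiable_mulmx => //; exact: differentiable_mulmx.
apply: differentiable_invmx dI.
by near=> z; apply: ind_metric_unitmx; near: z; exact: nearU.
Unshelve. all: by end_near. Qed.

(* The ambient derivative of the coordinate field [push F _ v] in direction
   [u], for the Levi-Civita and for the semi-symmetric connection. *)
Let L u v y := 'D_u ('D_v F) y + bform (lc_coeff G (F y)) ('D_u F y) ('D_v F y).
Let W u v y :=
  'D_u ('D_v F) y + bform (ssnm_coeff G w (F y)) ('D_u F y) ('D_v F y).

Let WE u v y : U y -> W u v y = L u v y + push F y (covpair (w (F y)) ('D_v F y) *: u).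
Proof.
move=> Uy; rewrite pushZ pushE // /W /L -ssnm_formE christoffel_formE.
by rewrite addrA.
Qed.

Let ssnm_along_push u v y : U y ->
  ssnm_along G w F (cst u) (push_field F (cst v)) y = W u v y.
Proof.
move=> Uy.
have E : 'D_u (push_field F (cst v)) y = 'D_u ('D_v F) y.
  apply: near_eq_derive; near=> z; apply: pushE.
  by near: z; exact: nearU.
by rewrite ssnm_along_cst E /push_field /cst (pushE u Uy) (pushE v Uy).
Unshelve. all: by end_near. Qed.

(** [W] and [L] differ by a tangent vector, so both connections have the same
    second fundamental form. *)
Let sffE y u v : U y -> sff G w F y u v = nor_part G F y (L u v y).
Proof.
move=> Uy; rewrite /sff (ssnm_along_push u v Uy) (WE u v Uy) nor_partD.
by rewrite (nor_part_push (ind_metric_unitmx Uy)) addr0.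
Qed.

Lemma sffC y u v : U y -> sff G w F y u v = sff G w F y v u.
Proof.
move=> Uy; apply: etrans (sffE u v Uy) (etrans _ (esym (sffE v u Uy))).
have S := smooth_derive_comm u v oU sF Uy.
have LS := lc_coeff_form_sym amb ('D_u F y) ('D_v F y) (FO Uy).
exact: (congr1 (nor_part G F y) (congr2 +%R S LS)).
Qed.

Lemma sff_linearl y k u u' v : U y ->
  sff G w F y (k *: u + u') v = k *: sff G w F y u v + sff G w F y u' v.
Proof.
move=> Uy; rewrite (sffE (k *: u + u') v Uy) (sffE u v Uy) (sffE u' v Uy).
rewrite -nor_partZ -nor_partD; congr nor_part.
have lin (f : 'rV[R]_n -> 'rV[R]_m) : differentiable f y ->
    'D_(k *: u + u') f y = k *: 'D_u f y + 'D_u' f y.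
  by move=> df; rewrite !deriveE // linearD linearZ.
have aux (C : 'I_m -> 'I_m -> 'rV[R]_m) (X0 X X' a0 a a' b : 'rV[R]_m) :
    X0 = k *: X + X' -> a0 = k *: a + a' ->
    X0 + bform C a0 b = k *: (X + bform C a b) + (X' + bform C a' b).
  by move=> -> ->; rewrite bformDl bformZl scalerDr addrACA.
exact: aux (lin _ (dDF v Uy)) (lin _ (dF Uy)).
Qed.

Lemma sff_normal y u v t : U y -> ip (G (F y)) (sff G w F y u v) (push F y t) = 0.
Proof. by move=> Uy; apply/nor_part_orth/ind_metric_unitmx. Qed.

(** Differentiating the constant product 0 of the normal field [V] and the
    tangent field [push F _ t] trades the derivative of [V] for the second
    fundamental form. The semi-symmetric connection adds [phi(V) u]. *)
Lemma weingarten q (V : 'rV[R]_n -> 'rV[R]_m) u t :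
  U q -> differentiable V q ->
  (\forall y \near q, ip (G (F y)) (V y) (push F y t) = 0) ->
  (forall s, ip (G (F q)) (V q) (push F q s) = 0) ->
  ip (G (F q)) (ssnm_along G w F (cst u) V q) (push F q t) =
  - ip (G (F q)) (V q) (sff G w F q u t)
  + covpair (w (F q)) (V q) * ip (ind_metric G F q) u t.
Proof.
move=> Uq dV Vt Vs; have Oq := FO Uq.
have dG : is_derive q u (fun y => G (F y)) ('D_('D_u F q) G (F q)).
  have d := differentiable_comp (dF Uq) (smooth_differentiable sG Oq).
  have -> : 'D_('D_u F q) G (F q) = 'D_u (G \o F) q.
    rewrite (deriveE _ d) (diff_comp (dF Uq) (smooth_differentiable sG Oq)) /=.
    by rewrite (deriveE _ (smooth_differentiable sG Oq)) (deriveE _ (dF Uq)).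
  exact/derivableP/diff_derivable.
have hV := derivableP (@diff_derivable _ _ _ _ _ u dV).
have hT := derivableP (@diff_derivable _ _ _ _ _ u (dDF t Uq)).
have [_ D0] := is_derive_ip dG hV hT.
have Z : 'D_u (fun y => ip (G (F y)) (V y) ('D_t F y)) q = 0.
  rewrite -(derive_cst (0 : R) q u); apply: near_eq_derive.
  near=> y; rewrite -pushE; last by near: y; exact: nearU.
  by near: y.
move: D0; rewrite Z (ip_derive_gram amb _ _ _ Oq) => E.
have -> : ip (G (F q)) (V q) (sff G w F q u t) = ip (G (F q)) (V q) (L u t q).
  by rewrite sffE // /nor_part ipBr Vs subr0.
rewrite ssnm_along_cst -ssnm_formE christoffel_formE ip_ind_metric addrA.
rewrite ipDl ipZl ipDl (pushE u Uq) (pushE t Uq) /L ipDr.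
move: E; set x1 := ip _ ('D_u V q) _; set x2 := ip _ (bform _ _ (V q)) _.
set x3 := ip _ (V q) (bform _ _ _); set x4 := ip _ (V q) ('D_u _ q).
move: x1 x2 x3 x4 => x1 x2 x3 x4 E.
by move: (covpair _ _ * _) => z; lra.
Unshelve. all: by end_near. Qed.

(** The derivative [W v z] of a tangent field splits into its tangential part,
    which the induced connection differentiates once more, and the normal
    field [nu v]. Differentiating the sum gives the ambient curvature by
    [curvature_along]; differentiating [nu v] gives the remaining terms by
    [weingarten]. *)
Lemma gauss_equation q u v z t : U q ->
  let g := ip (ind_metric G F q) in
  let s := sff G w F q in
  riem G w F q u v z t =
    ip (G (F q)) (coeff_curvature (ssnm_coeff G w) (F q)
      (push F q u) (push F q v) (push F q z)) (push F q t)
    + (ip (G (F q)) (s v z) (s u t) - ip (G (F q)) (s u z) (s v t))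
    - (covpair (w (F q)) (s v z) * g u t - covpair (w (F q)) (s u z) * g v t).
Proof.
move=> Uq g s.
have Iq := ind_metric_unitmx Uq.
have dC i j y : U y -> differentiable (fun x => ssnm_coeff G w (F x) i j) y.
  move=> Uy.
  exact: (differentiable_comp (dF Uy)
    (differentiable_ssnm_coeff amb i j (FO Uy))).
have dW a : differentiable (W a z) q.
  apply: (@differentiableD _ _ _ ('D_a ('D_z F))).
    exact: (smooth_differentiable (smooth_derive (smooth_derive sF z) a) Uq).
  by apply: differentiable_bform => [i j||]; [exact: dC|exact: dDF|exact: dDF].
pose tau a y := tan_part G F y (W a z y).
pose nu a y := W a z y - push F y (tau a y).
have nuE a y : U y -> nu a y = sff G w F y a z.
  by move=> Uy; rewrite /sff ssnm_along_push.
have dpt a : differentiable (fun y => push F y (tau a y)) q.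
  apply: differentiable_mulmx; last exact: differentiable_jacobian.
  exact: differentiable_tan_part.
have dnu a : differentiable (nu a) q.
  exact: (@differentiableB _ _ _ (W a z)).
have step a b : ip (ind_metric G F q)
    (ind_connection G w F (cst a) (ind_connection G w F (cst b) (cst z)) q) t =
  ip (G (F q)) ('D_a (W b z) q
      + bform (ssnm_coeff G w (F q)) (push F q a) (W b z q)) (push F q t)
  + ip (G (F q)) (s b z) (s a t) - covpair (w (F q)) (s b z) * g a t.
  rewrite /ind_connection ip_tan_part //.
  have -> : ssnm_along G w F (cst a)
      (push_field F (ind_connection G w F (cst b) (cst z))) q =
     ('D_a (W b z) q + bform (ssnm_coeff G w (F q)) (push F q a) (W b z q))
     - ssnm_along G w F (cst a) (nu b) q.
    rewrite !ssnm_along_cst.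
    have -> : push_field F (ind_connection G w F (cst b) (cst z)) q =
              W b z q - nu b q.
      by rewrite /push_field /ind_connection ssnm_along_push // /nu subKr.
    rewrite bformBr.
    have -> : 'D_a (push_field F (ind_connection G w F (cst b) (cst z))) q =
              'D_a (W b z) q - 'D_a (nu b) q.
      rewrite -deriveB; [|exact: diff_derivable|exact: diff_derivable].
      apply: near_eq_derive; near=> y.
      rewrite /push_field /ind_connection ssnm_along_push; last first.
        by near: y; exact: nearU.
      by rewrite /nu fctE subKr.
    by rewrite opprD addrACA.
  rewrite ipBl weingarten //; last 2 first.
  - near=> y; rewrite nuE; last by near: y; exact: nearU.
    by apply: sff_normal; near: y; exact: nearU.
  - by move=> r; rewrite nuE //; exact: sff_normal.
  by rewrite nuE // opprD opprK addrA.
have lie0 : ind_connection G w F (lie (cst u) (cst v)) (cst z) q = 0.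
  rewrite lie_cst /ind_connection ssnm_along_cst derive0 add0r.
  have -> : push F q 0 = 0 by rewrite /push mul0mx.
  by rewrite bform0l /tan_part !mul0mx.
rewrite /riem /curv4 /curvature lie0 subr0 ipBl (step u v) (step v u).
have key : ip (G (F q)) ('D_u (W v z) q
      + bform (ssnm_coeff G w (F q)) (push F q u) (W v z q)) (push F q t)
    - ip (G (F q)) ('D_v (W u z) q
      + bform (ssnm_coeff G w (F q)) (push F q v) (W u z q)) (push F q t)
    = ip (G (F q)) (coeff_curvature (ssnm_coeff G w) (F q)
        (push F q u) (push F q v) (push F q z)) (push F q t).
  rewrite -ipBl; congr (ip _ _ _).
  rewrite (pushE u Uq) (pushE v Uq) (pushE z Uq).
  exact: (curvature_along
    (fun i j => differentiable_ssnm_coeff amb i j (FO Uq))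
    (dF Uq) (dDF z Uq) (fun a => dDF a Uq)
    (fun a => smooth_differentiable (smooth_derive (smooth_derive sF z) a) Uq)
    (smooth_derive_comm u v oU sF Uq)
    (smooth_derive_comm u v oU (smooth_derive sF z) Uq)).
have aux (x y r p p' k k' : R) : x - y = r ->
    x + p - k - (y + p' - k') = r + (p - p') - (k - k').
  by move=> <-; ring.
exact: aux key.
Unshelve. all: by end_near. Qed.

End Gauss.

(** * Orthonormal frames *)

Section Frames.
Context {R : realType} {k : nat}.
Variables (G : 'M[R]_k) (r : 'I_k -> 'rV[R]_k).
Hypotheses (Gsym : G^T = G) (ron : forall i j, ip G (r i) (r j) = (i == j)%:R).

Let E := \matrix_i r i.

Let gramE u : u *m G *m E^T = \row_i ip G u (r i).
Proof.
by apply/rowP => i; rewrite /ip !mxE; apply: eq_bigr => j _; rewrite !mxE.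
Qed.

(** Orthonormality is E G E^T = 1; a one-sided inverse of a square matrix is
    two-sided, which is completeness of the frame. *)
Let frame_inverse : G *m E^T *m E = 1%:M.
Proof.
apply: mulmx1C; apply/row_matrixP => i; rewrite mulmxA !row_mul rowK gramE.
by apply/rowP => j; rewrite !mxE ron.
Qed.

Lemma frame_expansion u : u = \sum_i ip G u (r i) *: r i.
Proof.
rewrite -[LHS]mulmx1 -frame_inverse !mulmxA gramE mulmx_sum_row.
by apply: eq_bigr => i _; rewrite mxE rowK.
Qed.

Lemma parseval u v : ip G u v = \sum_i ip G u (r i) * ip G v (r i).
Proof.
rewrite {1}(frame_expansion u) ip_suml; apply: eq_bigr => i _.
by rewrite ipZl [ip G (r i) v]ipC.
Qed.

End Frames.

Lemma bilinear_frame_ext {R : realType} {n : nat} (I : 'M[R]_n)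
    (e' : 'I_n -> 'rV[R]_n) (B : 'rV[R]_n -> 'rV[R]_n -> R) :
  (forall i j, ip I (e' i) (e' j) = (i == j)%:R) ->
  (forall u u' a v, B (a *: u + u') v = a * B u v + B u' v) ->
  (forall u v, B u v = B v u) ->
  (forall i j, B (e' i) (e' j) = 0) -> forall u v, B u v = 0.
Proof.
move=> on Blin Bsym B0.
have B00 v : B 0 v = 0.
  have := Blin 0 0 1 v; rewrite scale1r addr0 mul1r => /eqP.
  by rewrite -subr_eq subrr => /eqP <-.
have ext v : (forall i, B (e' i) v = 0) -> forall u, B u v = 0.
  move=> Bv u; rewrite (frame_expansion on u).
  by elim/big_rec: _ => [|i x _ Bx]; rewrite ?B00 // Blin Bv mulr0 add0r.
move=> u v; apply: (ext) => i; rewrite Bsym.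
by apply: (ext) => j.
Qed.

(** * The Ricci curvature of the induced connection *)

Section Submanifold.
Context {R : realType} {n p : nat}.
Variables (G : 'rV[R]_(n + p) -> 'M[R]_(n + p)) (w : 'rV[R]_(n + p) -> 'rV[R]_(n + p)).
Variable F : 'rV[R]_n -> 'rV[R]_(n + p).
Variables (U : set 'rV[R]_n) (O : set 'rV[R]_(n + p)).
Hypotheses (amb : ambient_chart G w O) (imm : immersed_chart F U O).

Let Gsym := ambient_gram_sym amb.
Let Gpos := ambient_gram_pos amb.
Let FO := immersed_sub imm.
Variable c : R.
Hypothesis curv_c : forall y, O y -> forall u v s t,
  curv4 (levi_civita G) G y u v s t =
    c * (ip (G y) u t * ip (G y) v s - ip (G y) u s * ip (G y) v t).
Variable q : 'rV[R]_n.
Hypothesis Uq : U q.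
Variables (e : 'I_n -> 'rV[R]_n) (nu : 'I_p -> 'rV[R]_(n + p)).
Hypotheses (he : tangent_frame G F q e) (hnu : normal_frame G F q nu).

Let Oq := FO Uq.

Definition sff_matrix al : 'M[R]_n := \matrix_(i, j) sffc G w F q e nu al i j.

Lemma sff_matrix_sym al : (sff_matrix al)^T = sff_matrix al.
Proof.
apply/matrixP => i j; rewrite !mxE /sffc.
by rewrite (sffC amb imm (e j) (e i) Uq).
Qed.

Lemma mean_curvcE al :
  mean_curvc G w F q e nu al = n%:R^-1 * \tr (sff_matrix al).
Proof. by congr (_ * _); apply: eq_bigr => i _; rewrite mxE. Qed.

Lemma sffc_norm2E al :
  sffc_norm2 G w F q e nu al = \sum_i \sum_j sff_matrix al i j ^+ 2.
Proof. by apply: eq_bigr => i _; apply: eq_bigr => j _; rewrite mxE. Qed.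

(* The tangent and the normal frame together have as many vectors as the
   ambient dimension. *)
Let r (k : 'I_(n + p)) : 'rV[R]_(n + p) :=
  match fintype.split k with inl i => push F q (e i) | inr al => nu al end.

Let r_orthonormal i j : ip (G (F q)) (r i) (r j) = (i == j)%:R.
Proof.
have [h1 h2] := hnu.
rewrite /r -{2}(splitK i) -{2}(splitK j).
case: (fintype.split i) => i'; case: (fintype.split j) => j' /=.
- by rewrite -ip_ind_metric he eq_lshift.
- by rewrite ipC ?Gsym // h2 eq_lrshift.
- by rewrite h2 eq_rlshift.
- by rewrite h1 eq_rshift.
Qed.

Lemma parseval_normal u v :
  (forall s, ip (G (F q)) u (push F q s) = 0) ->
  ip (G (F q)) u v = \sum_al ip (G (F q)) u (nu al) * ip (G (F q)) v (nu al).
Proof.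
move=> un; rewrite (parseval (Gsym Oq) r_orthonormal) big_split_ord /=.
rewrite big1 ?add0r => [|i _]; last by rewrite /r (unsplitK (inl i)) un mul0r.
by apply: eq_bigr => al _; rewrite /r (unsplitK (inr al)).
Qed.

Let normal i j s : ip (G (F q)) (sff G w F q (e i) (e j)) (push F q s) = 0.
Proof. exact: (sff_normal amb imm (e i) (e j) s Uq). Qed.

Lemma mean_curv_normal s : ip (G (F q)) (mean_curv G w F q e) (push F q s) = 0.
Proof.
by rewrite ipZl ip_suml big1 ?mulr0 // => i _; exact: normal.
Qed.

Lemma ip_mean_curv al :
  ip (G (F q)) (mean_curv G w F q e) (nu al) = mean_curvc G w F q e nu al.
Proof. by rewrite ipZl ip_suml. Qed.

Lemma mean_normE :
  mean_norm G w F q e = Num.sqrt (\sum_al mean_curvc G w F q e nu al ^+ 2).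
Proof.
congr Num.sqrt; rewrite parseval_normal; last exact: mean_curv_normal.
by apply: eq_bigr => al _; rewrite ip_mean_curv.
Qed.

Lemma mean_norm_neq0 : (mean_norm G w F q e != 0) = (mean_curv G w F q e != 0).
Proof.
rewrite /mean_norm; have [->|H0] := eqVneq (mean_curv G w F q e) 0.
  by rewrite ip0l sqrtr0 eqxx.
by rewrite gt_eqF // sqrtr_gt0; exact: Gpos.
Qed.

Lemma covpair_normal v : (forall s, ip (G (F q)) v (push F q s) = 0) ->
  covpair (w (F q)) v = ip (G (F q)) (Pperp G w F q) v.
Proof.
move=> vn; rewrite -(sharpP w v (gram_unitmx amb Oq)) /Pperp /nor_part ipBl.
by rewrite [X in _ - X]ipC ?Gsym // vn subr0.
Qed.

(** In [gauss_equation] with u = t = e_k and v = z = e_j, the terms containing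
    <e_j, e_k> vanish, and the products of normal vectors expand over the
    normal frame. *)
Lemma riem_frame k j : j != k ->
  riem G w F q (e k) (e j) (e j) (e k) =
    c - s_tensor G w (F q) (push F q (e j)) (push F q (e j))
    - ip (G (F q)) (Pperp G w F q) (sff G w F q (e j) (e j))
    + \sum_al (sff_matrix al k k * sff_matrix al j j - sff_matrix al k j ^+ 2).
Proof.
move=> jk.
have ipe a b : ip (G (F q)) (push F q (e a)) (push F q (e b)) = (a == b)%:R.
  by rewrite -ip_ind_metric he.
have aux (x st y z k1 k2 g1 g2 s1 s2 t : R) : x = c - st -> y = s1 -> z = s2 ->
    k1 = t -> g1 = 1 -> g2 = 0 ->
    x + (y - z) - (k1 * g1 - k2 * g2) = c - st - t + (s1 - s2).
  by move=> -> -> -> -> -> ->; ring.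
have -> : \sum_al (sff_matrix al k k * sff_matrix al j j - sff_matrix al k j ^+ 2) =
    \sum_al sffc G w F q e nu al j j * sffc G w F q e nu al k k
    - \sum_al sffc G w F q e nu al k j * sffc G w F q e nu al j k.
  rewrite -sumrB; apply: eq_bigr => al _.
  have entry i l : sff_matrix al i l = sffc G w F q e nu al i l by rewrite mxE.
  have Skj : sff_matrix al k j = sffc G w F q e nu al j k.
    by rewrite -(sff_matrix_sym al) mxE entry.
  have aux2 (x y z x' y' z1 z2 : R) : x = x' -> y = y' -> z = z1 -> z = z2 ->
      x * y - z ^+ 2 = y' * x' - z1 * z2.
    by move=> -> -> <- <-; ring.
  exact: aux2 (entry k k) (entry j j) (entry k j) Skj.
apply: etrans (gauss_equation amb imm (e k) (e j) (e j) (e k) Uq) _.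
apply: aux.
- rewrite (coeff_curvature_ssnm amb _ _ _ Oq) -curvature_levi_civita.
  rewrite ipDl [X in _ + X = _]ipBl !ipZl.
  have := curv_c Oq (push F q (e k)) (push F q (e j)) (push F q (e j)) (push F q (e k)).
  rewrite /curv4 => ->; rewrite !ipe !eqxx eq_sym (negbTE jk) /=.
  by move: (s_tensor _ _ _ _ _) (s_tensor _ _ _ _ _) => x1 x2; ring.
- exact: (parseval_normal _ (normal j j)).
- exact: (parseval_normal _ (normal k j)).
- exact: (covpair_normal (normal j j)).
- by rewrite he eqxx.
- by rewrite he (negbTE jk).
Qed.

Lemma ric_formula (k : 'I_n) : (0 < n)%N ->
  ric G w F q e k =
    (n%:R - 1) * c - trace_s G w F q e
    + s_tensor G w (F q) (push F q (e k)) (push F q (e k))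
    - n%:R * ip (G (F q)) (Pperp G w F q) (mean_curv G w F q e)
    + ip (G (F q)) (Pperp G w F q) (sff G w F q (e k) (e k))
    + \sum_al (sff_matrix al k k * (\sum_(j < n | j != k) sff_matrix al j j)
               - \sum_(j < n | j != k) sff_matrix al k j ^+ 2).
Proof.
move=> n0; rewrite /ric (eq_bigr _ (fun j jk => riem_frame jk)).
rewrite big_split sumrB [X in X - _ + _ = _]sumrB /=.
have -> : \sum_(j < n | j != k) c = (n%:R - 1) * c.
  rewrite sumr_const (_ : #|_| = n.-1); last by rewrite -[in RHS](card_ord n) -(cardC1 k).
  have -> : n%:R = n.-1%:R + 1 :> R by rewrite natr1 prednK.
  by rewrite addrK mulr_natl.
have -> : \sum_(j < n | j != k) \sum_al
    (sff_matrix al k k * sff_matrix al j j - sff_matrix al k j ^+ 2) =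
  \sum_al (sff_matrix al k k * (\sum_(j < n | j != k) sff_matrix al j j)
               - \sum_(j < n | j != k) sff_matrix al k j ^+ 2).
  rewrite exchange_big; apply: eq_bigr => al _ /=.
  by rewrite sumrB mulr_sumr.
have -> : n%:R * ip (G (F q)) (Pperp G w F q) (mean_curv G w F q e) =
    \sum_j ip (G (F q)) (Pperp G w F q) (sff G w F q (e j) (e j)).
  rewrite ipC ?Gsym // ipZl mulVKf ?pnatr_eq0 -?lt0n // ip_suml.
  by apply: eq_bigr => j _; rewrite ipC ?Gsym.
have split_k (f : 'I_n -> R) : \sum_j f j = f k + \sum_(j < n | j != k) f j.
  exact: bigD1.
have aux (x A a s B b t y : R) : A = a + s -> B = b + t ->
    x - s - t + y = x - A + a - B + b + y.
  by move=> -> ->; ring.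
exact: aux (split_k _) (split_k _).
Qed.

(** The hypothesis determines the bilinear form <sigma(u, v), nu al> as
    b <u, v> + (a - b) <u, e_k> <v, e_k>, which has the same matrix in every
    orthonormal frame containing e_k in place k. *)
Lemma sffc_quasi_umbilical_frame al k (e' : 'I_n -> 'rV[R]_n) (a b : R) :
  tangent_frame G F q e' -> e' k = e k ->
  (forall i j, sffc G w F q e' nu al i j =
     if i == j then if i == k then a else b else 0) ->
  forall i j, sffc G w F q e nu al i j =
     if i == j then if i == k then a else b else 0.
Proof.
move=> he' e'k Q i j.
have Is : (ind_metric G F q)^T = ind_metric G F q.
  by rewrite /ind_metric !trmx_mul trmxK Gsym // mulmxA.
pose g := ip (ind_metric G F q).
pose B u v := ip (G (F q)) (sff G w F q u v) (nu al)
  - b * g u v - (a - b) * (g u (e k) * g v (e k)).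
have diag (f : 'I_n -> 'rV[R]_n) s t : tangent_frame G F q f -> f k = e k ->
    (if s == t then if s == k then a else b else 0) =
    b * g (f s) (f t) + (a - b) * (g (f s) (e k) * g (f t) (e k)).
  move=> hf <-; rewrite /g !hf; have [<-|st] := eqVneq s t.
    by case: (s == k); rewrite /=; ring.
  have [sk|_] := eqVneq s k; last by rewrite /=; ring.
  by rewrite -sk [t == s]eq_sym (negbTE st) /=; ring.
have B0 u v : B u v = 0.
  apply: (bilinear_frame_ext (B := B) he') => {u v} [u u' d v|u v|s t].
  - have gl x : g (d *: u + u') x = d * g u x + g u' x by rewrite /g ipDl ipZl.
    rewrite /B (sff_linearl amb imm d u u' v Uq) ipDl ipZl (gl v) (gl (e k)).
    move: (g u v) (g u' v) (g u (e k)) (g u' (e k)) (g v (e k)).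
    by move: (ip _ _ (nu al)) (ip _ _ (nu al)) => *; ring.
  - rewrite /B (sffC amb imm u v Uq) /g [ip _ u v]ipC //.
    by congr (_ - _ * _); rewrite mulrC.
  - have E : sffc G w F q e' nu al s t = _ := etrans (Q s t) (diag e' s t he' e'k).
    have aux (x y z : R) : x = y + z -> x - y - z = 0 by move=> ->; ring.
    exact: aux E.
have aux (x y z : R) : x - y - z = 0 -> x = y + z by lra.
exact: etrans (aux _ _ _ (B0 (e i) (e j))) (esym (diag e i j he erefl)).
Qed.

End Submanifold.

(** * From manifolds to charts *)

Lemma chart_image_open {R : realType} {T : topologicalType} {n : nat}
    (a : chart R T n) (D : set T) :
  open D -> D `<=` chart_dom a -> open (chart_map a @` D).
Proof.
move=> oD Da; rewrite openE => _ [x Dx <-].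
have ax : (chart_map a @` chart_dom a) (chart_map a x) by exists x => //; exact: Da.
have cD : \forall y \near chart_map a x, D (chart_inv a y).
  apply: (chart_inv_continuous ax); rewrite chart_mapK; last exact: Da.
  exact: open_nbhs_nbhs.
have aI : \forall y \near chart_map a x, (chart_map a @` chart_dom a) y.
  by apply: open_nbhs_nbhs; split=> //; exact: chart_img_open.
apply: filterS2 cD aI => y Dy [z az zy]; exists (chart_inv a y) => //.
by rewrite -zy chart_mapK.
Qed.

Theorem theorem4p1 (R : realType) (n p : nat) (hn : (2 <= n)%N) (c : R)
    (N : manifold R (n + p)) (g : metric N) (hc : constant_curvature g c)
    (phi : one_form N)
    (M : manifold R n) (f : M -> N) (hf : immersion f)
    (x : M) (a : chart R M n) (ha : atlas a) (hx : chart_dom a x)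
    (b : chart R N (n + p)) (hb : atlas b) (hfx : chart_dom b (f x)) :
  let G := gram g b in
  let w := form_comp phi b in
  let F := local_rep f a b in
  let q := chart_map a x in
  let i1 := Ordinal (ltnW hn) in
  forall (X : 'rV[R]_n) (hX : ip (ind_metric G F q) X X = 1)
    (e : 'I_n -> 'rV[R]_n) (he : tangent_frame G F q e) (heX : e i1 = X)
    (nu : 'I_p -> 'rV[R]_(n + p)) (hnu : normal_frame G F q nu),
  let H := mean_curv G w F q e in
  let normH := mean_norm G w F q e in
  let S := sff_norm2 G w F q e nu in
  let Hc := mean_curvc G w F q e nu in
  let Sc := sffc_norm2 G w F q e nu in
  let Dc := fun al => deviation n (Hc al) (Sc al) in
  let ricX := ric G w F q e i1 in
  let bound :=
    (n%:R - 1) * c - trace_s G w F q e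
    + s_tensor G w (F q) (push F q X) (push F q X)
    - n%:R * ip (G (F q)) (Pperp G w F q) H
    + ip (G (F q)) (Pperp G w F q) (sff G w F q X X)
    + calH n normH S in
  bound <= ricX /\
  ((2 < n)%N ->
    (ricX = bound <->
      (forall al : 'I_p,
         exists (e' : 'I_n -> 'rV[R]_n) (eps : R),
           [/\ tangent_frame G F q e', e' i1 = X, is_sign eps (Hc al) &
             forall i j, sffc G w F q e' nu al i j =
               if i == j then
                 (if i == i1 then lambda_ev n eps (Hc al) (Sc al)
                  else mu_ev n eps (Hc al) (Sc al))
               else 0]) /\
      (H != 0 ->
         exists2 rho : R, 0 <= rho & forall al, Dc al = rho * `|Hc al|))) /\
  (n = 2%N ->
    (forall A : 'M[R]_n, A^T = A ->
       A i1 i1 * (\sum_(j < n | j != i1) A j j)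
         - \sum_(j < n | j != i1) (A i1 j) ^+ 2
       = calH n `|n%:R^-1 * \tr A| (\sum_(i < n) \sum_(j < n) (A i j) ^+ 2)) /\
    \sum_(al < p) `|Hc al| * Dc al <= normH * deviation n normH S /\
    (ricX = bound <->
       (n%:R - 2) * (\sum_(al < p) `|Hc al| * Dc al)
       = (n%:R - 2) * (normH * deviation n normH S))).
Proof.
move=> G w F q i1 X hX e he heX nu hnu H normH S Hc Sc Dc ricX bound.
set O := chart_img b.
set U := chart_map a @` (chart_dom a `&` f @^-1` chart_dom b).
have n0 : (0 < n)%N by exact: (ltnW hn).
have [fcont frep] := hf.
have amb : ambient_chart G w O.
  split; first exact: chart_img_open.
  - exact: gram_smooth.
  - exact: form_smooth.
  - by move=> y Oy; exact: (@gram_sym _ _ _ g b hb y Oy).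
  - by move=> y Oy; exact: (@gram_pos _ _ _ g b hb y Oy).
have FE z : chart_dom a z -> F (chart_map a z) = chart_map b (f z).
  by move=> az; rewrite /F /local_rep /= chart_mapK.
have imm : immersed_chart F U O.
  split.
  - apply: chart_image_open; last by move=> z [].
    apply: openI; first exact: chart_dom_open.
    by apply: open_comp; [move=> z _; exact: fcont|exact: chart_dom_open].
  - by have [] := frep a b ha hb.
  - by move=> _ [z [az bz] <-]; rewrite FE //; exists (f z).
  - by move=> _ [z [az bz] <-]; have [_] := frep a b ha hb; apply.
have Uq : U q by exists x.
have cc y : O y -> forall u v s t, curv4 (levi_civita G) G y u v s t =
    c * (ip (G y) u t * ip (G y) v s - ip (G y) u s * ip (G y) v t).
  by move=> Oy u v s t; exact: (hc b hb y Oy u v s t).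
pose A := sff_matrix G w F q e nu.
have Asym al : (A al)^T = A al by exact: (sff_matrix_sym amb imm Uq).
have HcE al : Hc al = n%:R^-1 * \tr (A al) by exact: mean_curvcE.
have ScE al : Sc al = \sum_i \sum_j A al i j ^+ 2 by exact: sffc_norm2E.
have normHE : normH = Num.sqrt (\sum_al (n%:R^-1 * \tr (A al)) ^+ 2).
  rewrite /normH (mean_normE amb imm Uq he hnu).
  by congr Num.sqrt; apply: eq_bigr => al _; rewrite mean_curvcE.
have SE : S = \sum_al \sum_i \sum_j A al i j ^+ 2.
  by apply: eq_bigr => al _; exact: sffc_norm2E.
have DcE al : Dc al = deviation n (n%:R^-1 * \tr (A al)) (\sum_i \sum_j A al i j ^+ 2).
  by rewrite /Dc HcE ScE.
have [base [ricE boundE]] : exists base,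
    ricX = base + \sum_al (A al i1 i1 * (\sum_(j < n | j != i1) A al j j)
               - \sum_(j < n | j != i1) A al i1 j ^+ 2) /\
    bound = base + calH n normH S.
  eexists; split; last reflexivity.
  by have := ric_formula amb imm cc Uq he hnu i1 n0; rewrite heX.
have ric_eq : ricX = bound <->
    \sum_al (A al i1 i1 * (\sum_(j < n | j != i1) A al j j)
             - \sum_(j < n | j != i1) A al i1 j ^+ 2) = calH n normH S.
  by rewrite ricE boundE; split=> [/addrI|->].
split; [|split].
- rewrite ricE boundE lerD2l normHE SE.
  exact: sum_quasi_umbilical_estimate.
- move=> n3; rewrite ric_eq normHE SE sum_quasi_umbilical_equality //.
  rewrite -normHE (mean_norm_neq0 amb imm Uq) -/H.
  split=> [[Q rho]|[Q rho]]; split.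
  + move=> al; have [eps seps form] := Q al.
    exists e, eps; split=> //; first by rewrite HcE.
    by move=> i j; rewrite HcE ScE -form mxE.
  + move=> H0; have [r r0 rE] := rho H0; exists r => // al.
    by rewrite DcE HcE rE.
  + move=> al; have [e' [eps [he' e'X seps form]]] := Q al.
    exists eps; first by rewrite -HcE.
    move=> i j; rewrite mxE -HcE -ScE.
    apply: (sffc_quasi_umbilical_frame amb imm Uq he he') form i j.
    by rewrite e'X heX.
  + move=> H0; have [r r0 rE] := rho H0; exists r => // al.
    by rewrite -DcE rE HcE.
- move=> n2; split; [|split].
  + by move=> B Bsym; exact: quasi_umbilical_dim2.
  + have := sum_norm_deviation_le i1 hn Asym; rewrite -normHE -SE.
    by under eq_bigr do rewrite -DcE -HcE.
  + rewrite ric_eq normHE SE; split=> _.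
      have -> : n%:R - 2 = 0 :> R by rewrite n2 subrr.
      by rewrite !mul0r.
    exact: sum_quasi_umbilical_dim2.
Qed.
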